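(* Let $M$ be a connected stellar $n$-manifold with a finite number of generators. Then there exist a stellar $(n-1)$-sphere $S$, a vertex $a\notin S$, and a regular equivalence relation $\simeq$ on the set of vertices of $S$ such that $M$ admits the triangulation $$N = a\star (S/\simeq),$$ i.e. $M\sim a\star(S/\simeq)$. Moreover, if $M$ is closed, then for any generator $g\in S$ there exists exactly one generator $p\in S\setminus g$ such that $g\simeq p$.
   Context: **Complexes.** Vertices are labelled by integers. A simplex is identified with the finite set of its vertices, $s=(i_1\ i_2\ \dots\ i_{m+1})$ being an $m$-simplex. A complex whose generators (maximal simplexes) all have the same dimension is called uniform. A uniform $n$-dimensional complex is written as the sum, with coefficients in $\mathbb{Z}_2$, of its $n$-simplexes $g_i$, $M=\sum_i g_i$; the $g_i$ are its generators. $M\setminus g$ denotes the complex defined by all generators of $M$ other than $g$. The boundary operator is $\partial(i_1\ \dots\ i_{n+1})=\sum_{j}(i_1\ \dots\ \widehat{i_j}\ \dots\ i_{n+1})$ mod 2, extended linearly. $M$ is closed if $\partial M=0$. Topological properties of $M$ (such as connectedness) are those of its standard geometric realization. **Join, link.** The join of two simplexes without common vertices is the union of their vertex sets; for complexes $K=\sum_i q_i$ and $L=\sum_j p_j$ without common vertices, $K\star L=\sum_{i,j}q_i\star p_j$. For a simplex $A$ of $K$, $lk(A,K)=\{B\in K : A\star B\in K\}$, and $K=A\star lk(A,K)+Q(A,K)$, where $Q(A,K)$ is composed of all generators of $K$ not containing $A$. **Stellar moves.** Subdivision: if $A$ is a simplex of $K$ and $a$ is an integer that is not a vertex of $K$,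 then $(A\ a)K=a\star\partial A\star lk(A,K)+Q(A,K)$. Weld (inverse of subdivision): if $\hat K=a\star lk(a,\hat K)+Q(a,\hat K)$ with $lk(a,\hat K)=\partial A\star B$, where $B$ is a subcomplex of $\hat K$ and $A$ is a simplex with $A\notin\hat K$, then $(A\ a)^{-1}\hat K=A\star B+Q(a,\hat K)$. A stellar move is a subdivision, a weld, or a change of the enumeration of the vertices. Two complexes are stellar equivalent, $M\sim L$, if one is obtained from the other by a finite sequence of stellar moves; one then also says that $M$ admits the triangulation $L$. **Stellar balls, spheres, manifolds.** A stellar $n$-ball is a complex stellar equivalent to $(1\ 2\ \dots\ n+1)$; a stellar $n$-sphere is a complex stellar equivalent to $\partial(1\ 2\ \dots\ n+2)$. A complex $M$ is a stellar $n$-manifold if for every vertex $i$ of $M$ the link $lk(i,M)$ is either a stellar $(n-1)$-ball or a stellar $(n-1)$-sphere. **Regular equivalence.** An equivalence relation $\simeq$ on the set of vertices of a stellar manifold $S$ is regular if: (i) no generator $g\in S$ has two vertices that are equivalent to each other; (ii) for any generator $g\in S$ there is at most one generator $p\in S\setminus g$ such that every vertex of $g$ is equal or equivalent to some vertex of $p$. Two such generators are called equivalent, $g\simeq p$. **The object $a\star(S/\simeq)$.** It is obtained from the ball $a\star S$ by identifying equivalent vertices of $S$, and correspondingly identifying simplexes of $S$ whose vertices match under $\simeq$ (in particular equivalent generators $g\simeq p$ of $S$ are identified, via the vertex matching). However, the generators $a\star g$ and $a\star p$ remain distinct even when $g\simeq p$. Hence $a\star(S/\simeq)$ is in general a generalized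 complex, in which a simplex need not be determined by its set of vertices. Stellar moves on such a generalized complex are subdivisions, welds and changes of the enumeration of the vertices, where the subdivision at a simplex $A$ with a new vertex $b$ (an integer that is not yet a vertex) replaces each generator $A\star B$ having $A$ as a face by the generators of $b\star\partial A\star B$ and leaves the generators not containing $A$ unchanged, and a weld is the inverse operation of such a subdivision. *)

(* Defs.v *)
From HB Require Import structures.
From mathcomp Require Import all_boot all_order all_algebra.
From mathcomp Require Import finmap.
From mathcomp Require Import all_classical all_reals topology normedtype.
From Stdlib Require Import Relations.

Set Implicit Arguments.
Unset Strict Implicit.
Unset Printing Implicit Defensive.

Import Order.TTheory GRing.Theory Num.Theory.
Import numFieldNormedType.Exports.

Local Open Scope fset_scope.

(** * Simplicial complexes, presented by their generators *)

(* A simplex is its set of vertices; the empty simplex is allowed, so that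
   e.g. the link of a generator is [fset fset0], the unit of the join. *)
Definition simplex := {fset int}.

(* The formal sum of the generators, with coefficients in Z/2, is identified
   with its support; in particular every complex here has finitely many
   generators, and the zero complex is fset0. *)
Definition complex := {fset simplex}.

Definition uniform (n : nat) (K : complex) : Prop :=
  forall g, g \in K -> #|` g| = n.+1.

Definition is_simplex (K : complex) (A : simplex) : Prop :=
  exists2 g, g \in K & A `<=` g.

Definition verts (K : complex) : {fset int} := \bigcup_(g <- K) g.

Definition simplex_bd (A : simplex) : complex := [fset A `\ v | v in A].

(* The Z/2-linear extension of simplex_bd: a face survives when it occurs in
   an odd number of generators. The boundary of a 0-simplex is the empty
   simplex, as in the formula for the boundary of (i_1 ... i_(n+1)). *)
Definition boundary (K : complex) : complex :=
  [fset f in \bigcup_(g <- K) simplex_bd g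
    | odd #|` [fset g in K | f \in simplex_bd g]|].

Definition closed_complex (K : complex) : Prop := boundary K = fset0.

Definition no_common_vertex (K L : complex) : Prop :=
  [disjoint verts K & verts L].

(* Meaningful when no_common_vertex K L. *)
Definition join (K L : complex) : complex :=
  [fset q `|` p | q in K, p in L].

(* The generators of lk(A,K); see is_simplex_link. *)
Definition link (A : simplex) (K : complex) : complex :=
  [fset g `\` A | g in [fset h in K | A `<=` h]].

Definition rest (A : simplex) (K : complex) : complex :=
  [fset g in K | ~~ (A `<=` g)].

Lemma is_simplex_link (A : simplex) (K : complex) (B : simplex) :
  is_simplex (link A K) B <-> [disjoint A & B] /\ is_simplex K (A `|` B).
Proof.
split=> [[_ /imfsetP [g /= + ->]]|[dAB [g gK]]].
  rewrite !inE /= => /andP [gK Ag] /fsubsetP BgA; split; last first.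
    exists g => //; rewrite fsubUset Ag; apply/fsubsetP => v /BgA.
    by rewrite inE => /andP [].
  apply/fdisjointP => v vA; apply/negP => /BgA.
  by rewrite inE vA.
rewrite fsubUset => /andP [Ag Bg]; exists (g `\` A).
  by apply/imfsetP; exists g => //=; rewrite !inE /= gK Ag.
by rewrite fsubsetD Bg fdisjoint_sym.
Qed.

(** * Stellar moves *)

(* The simplex A of a move is nonempty. The two summands of the result have
   no generator in common, so the sum is a union. *)
Definition subdivision (K L : complex) : Prop :=
  exists (A : simplex) (a : int),
    [/\ A != fset0, is_simplex K A, a \notin verts K &
        L = join [fset [fset a]] (join (simplex_bd A) (link A K))
              `|` rest A K].

Definition weld (K L : complex) : Prop :=
  exists (A : simplex) (a : int) (B : complex),
    [/\ A != fset0, a \in verts K & ~ is_simplex K A] /\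
    [/\ (forall b, b \in B -> is_simplex K b),
        no_common_vertex [fset A] B,
        link [fset a] K = join (simplex_bd A) B &
        L = join [fset A] B `|` rest [fset a] K].

Definition renumbering (K L : complex) : Prop :=
  exists f : int -> int,
    {in verts K &, injective f} /\
    L = [fset [fset f v | v in (g : simplex)] | g in K].

Definition stellar_move (K L : complex) : Prop :=
  [\/ subdivision K L, weld K L | renumbering K L].

Definition stellar_equiv : relation complex :=
  clos_refl_trans complex stellar_move.

(* The simplex (1 2 ... m), of dimension m - 1. *)
Definition std_simplex (m : nat) : simplex := [fset Posz i | i in iota 1 m].

(* Balls and spheres are indexed by the number m of vertices of a generator,
   i.e. these are the stellar (m-1)-balls and the stellar (m-1)-spheres. For
   m = 0 both are the complex whose only simplex is empty. *)
Definition stellar_ball (m : nat) (K : complex) : Prop :=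
  stellar_equiv K [fset std_simplex m].

Definition stellar_sphere (m : nat) (K : complex) : Prop :=
  stellar_equiv K (simplex_bd (std_simplex m.+1)).

Definition stellar_manifold (n : nat) (M : complex) : Prop :=
  uniform n M /\
  forall i, i \in verts M ->
    stellar_ball n (link [fset i] M) \/ stellar_sphere n (link [fset i] M).

(** * Geometric realization *)

(* Points are given by their barycentric coordinates. For a finite complex
   the topology induced by the product of countably many copies of R is the
   usual one. *)
Definition realization (R : realType) (K : complex) :
    set {ptws int -> R} :=
  [set x : {ptws int -> R} | exists2 g : simplex, g \in K &
     [/\ forall v, (0 <= x v)%R,
         forall v, v \notin g -> x v = 0%R &
         (\sum_(v <- g) x v)%R = 1%R]]%classic.
Arguments realization : clear implicits.

(** * Regular equivalences *)

Definition gen_equiv (e : rel int) (g p : simplex) : Prop :=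
  forall v, v \in g -> exists2 w, w \in p & v = w \/ e v w.

(* Only the values of e on vertices of S matter. *)
Definition regular (S : complex) (e : rel int) : Prop :=
  [/\ {in verts S & &, equivalence_rel e},
      forall g, g \in S -> {in g &, forall v w, e v w -> v = w} &
      forall g p q, g \in S -> p \in S `\ g -> q \in S `\ g ->
        gen_equiv e g p -> gen_equiv e g q -> p = q].

(** * Generalized complexes *)

(* A finite family of generators, each with its set of vertices, together with
   the identifications between their faces: gglue i j F means that the
   generators i and j have their faces with vertex set F in common. Thus a
   simplex with vertex set F is a class, for gglue, of generators i with
   F `<=` gvert i, and two different simplexes may have the same vertices. *)
Record gcomplex := GComplex {
  gidx : finType;
  gvert : gidx -> simplex;
  gglue : gidx -> gidx -> simplex -> bool }.

Record gcomplex_axioms (K : gcomplex) : Prop := GComplexAxioms {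
  gglue_sub : forall (i j : gidx K) F,
    gglue i j F -> F `<=` gvert i `&` gvert j;
  gglue_refl : forall (i : gidx K) F, F `<=` gvert i -> gglue i i F;
  gglue_sym : forall (i j : gidx K) F, gglue i j F -> gglue j i F;
  gglue_trans : forall (i j k : gidx K) F,
    gglue i j F -> gglue j k F -> gglue i k F;
  gglue_face : forall (i j : gidx K) F G,
    gglue i j F -> G `<=` F -> gglue i j G;
  (* vertices, and the empty simplex, are determined by their vertex sets *)
  gglue_vertex : forall (i j : gidx K) F,
    #|` F| <= 1 -> F `<=` gvert i `&` gvert j -> gglue i j F;
  (* no generator is a face of another one *)
  gglue_max : forall i j : gidx K, gglue i j (gvert i) -> i = j }.

Definition gcomplex_of (K : complex) : gcomplex :=
  @GComplex K (fun g => val g) (fun g h F => F `<=` val g `&` val h).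

(* The subdivision at the simplex A of the generator i, with new vertex b.
   A generator j containing that simplex is replaced by the generators
   (j, Some v), v in A, spanned by b and the face of j opposite to v; the
   other generators are kept as (j, None). *)
Section GSubdivision.
Variables (K : gcomplex) (i : gidx K) (A : simplex) (b : int).

Definition gsubdiv_idx : finType :=
  {x : gidx K * option A | isSome x.2 == gglue i x.1 A}.

Definition gsubdiv_vert (x : gsubdiv_idx) : simplex :=
  if (val x).2 is Some v then b |` (gvert (val x).1 `\ val v)
  else gvert (val x).1.

(* Faces without b are glued as before. A face containing b has the form
   b * C * D with C a proper face of A and D disjoint from A, and lies in the
   interior of the simplex A * D of K. *)
Definition gsubdiv_glue (x y : gsubdiv_idx) (F : simplex) : bool :=
  (F `<=` gsubdiv_vert x `&` gsubdiv_vert y) &&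
  gglue (val x).1 (val y).1 (if b \in F then A `|` (F `\ b) else F).

Definition gsubdiv : gcomplex := GComplex gsubdiv_vert gsubdiv_glue.
End GSubdivision.

Definition gsubdivision (K L : gcomplex) : Prop :=
  exists (i : gidx K) (A : simplex) (b : int),
    [/\ A != fset0, A `<=` gvert i, (forall j : gidx K, b \notin gvert j) &
        L = gsubdiv i A b].

Definition gweld (K L : gcomplex) : Prop := gsubdivision L K.

(* The names of the generators are immaterial, hence the bijection phi. *)
Definition grenumbering (K L : gcomplex) : Prop :=
  exists (phi : gidx K -> gidx L) (f : int -> int),
    [/\ bijective phi,
        (forall (i j : gidx K) v w, v \in gvert i -> w \in gvert j ->
           f v = f w -> v = w),
        (forall i : gidx K, gvert (phi i) = [fset f v | v in gvert i]) &
        (forall (i j : gidx K) (F : simplex), F `<=` gvert i ->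
           gglue (phi i) (phi j) [fset f v | v in F] = gglue i j F)].

Definition gstellar_move (K L : gcomplex) : Prop :=
  [/\ gcomplex_axioms K, gcomplex_axioms L &
      [\/ gsubdivision K L, gweld K L | grenumbering K L]].

Definition gstellar_equiv : relation gcomplex :=
  clos_refl_trans gcomplex gstellar_move.

(** * The generalized complex a * (S/e) *)

(* The class of v is represented by the first vertex of S, in the enumeration
   of verts S, that is equivalent to v. *)
Definition class_repr (S : complex) (e : rel int) (v : int) : int :=
  head v [seq w <- verts S | e v w].

Definition class_image (S : complex) (e : rel int) (s : simplex) : simplex :=
  [fset class_repr S e v | v in s].

(* The generators are the a * g, for all generators g of S. Simplexes of S
   (not containing a) are identified when they have the same image in the
   quotient, but the simplexes a * s, for s a simplex of S, are not identified
   with each other: a face F containing a is common to a * g and a * h only if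
   it comes from a common face of g and h. *)
Definition cone_quotient (S : complex) (a : int) (e : rel int) : gcomplex :=
  @GComplex S
    (fun g => a |` class_image S e (val g))
    (fun g h F =>
       (F `<=` (a |` class_image S e (val g))
               `&` (a |` class_image S e (val h))) &&
       ((a \in F) ==> (F `<=` a |` class_image S e (val g `&` val h)))).

(* Main.v *)
Require Import Defs.
From HB Require Import structures.
From mathcomp Require Import all_boot all_order all_algebra.
From mathcomp Require Import finmap.
From mathcomp Require Import all_classical all_reals topology normedtype.
From mathcomp Require Import lra zify.
From Stdlib Require Import Relations.

Import numFieldNormedType.Exports.

(** Cut [M] open along a spanning tree of its dual graph. Start from one
    generator, subdivided at itself by a new vertex [a]: it is the cone from
    [a] over the boundary of a simplex. As long as some generator of [M] has
    not been absorbed in the cone, one of them, [t], shares a facet with the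
    base of the cone: [t] is spanned by a vertex [v] and by the image of a
    generator [f] of the current sphere [S]. The two generators [a * f] and
    [v * f] fill the same ball as the join of the edge [a v] and the boundary
    of [f], and one passes from the former to the latter by a subdivision at
    [f] followed by a weld at the edge. In the new cone [f] is replaced in
    [S] by the cone over its boundary from a vertex lying over [v]. This vertex
    is always taken new: then [S] is merely subdivided at a generator, so that
    it stays a sphere, and it is the generalized complex that remembers which
    vertices of [S] lie over the same vertex of [M].

    Three things have to be known about [M].
    - A facet lies in at most two generators ([thin]), so that there is no
      third generator around [f] and the move above is legitimate, and so that
      at most two generators of the final sphere lie over the same facet. This
      property of complexes is invariant under stellar moves, hence holds for
      balls and spheres, hence for the links of [M] and for [M].
    - The absorbed generators can always be extended unless they are all the
      generators. Strong connectedness ([chained]) is also invariant under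
      stellar moves, so that it holds for links; a set of generators closed
      under adjacency is thus a union of stars of vertices, and
      [connected_color] derives from the connectedness of the realization that
      it is everything.
    - The number of absorbed generators around a facet minus the number of
      generators of [S] over this facet is always even, since they differ
      exactly by the facets along which the spanning tree passes. For a closed
      [M] this makes the number of generators of [S] over a facet even, hence
      0 or 2.

    The generalized complexes met on the way are all presented ([realizes]) by
    an ordinary complex [X], a labelling [p] of its vertices and a set [Z] of
    marked vertices: the generators of [X] are glued along every face with
    equal labels, except that the faces with a marked vertex are glued only
    where they coincide in [X]. Subdivision commutes with this presentation
    ([gsubdivision_realizes]), and an unmarked generator may be replaced by
    any other one with the same labels ([realizes_relift]). Before absorbing
    [t], it is replaced by [w * f] with [w] new; the subdivision at [f] and
    the subdivision at the edge [a w] then produce the same ordinary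
    complex. *)

Set Implicit Arguments.
Unset Strict Implicit.
Unset Printing Implicit Defensive.

Import Order.TTheory GRing.Theory Num.Theory.

Local Open Scope fset_scope.

(** * Subdivisions and welds in terms of generators *)

Definition stellar_sub (A : simplex) (a : int) (K : complex) : complex :=
  join [fset [fset a]] (join (simplex_bd A) (link A K)) `|` rest A K.

Lemma in_verts (K : complex) v :
  reflect (exists2 g, g \in K & v \in g) (v \in verts K).
Proof.
apply: (iffP (bigfcupP _ _ _ _)) => [[g /andP[gK _] vg]|[g gK vg]]; exists g => //.
by rewrite gK.
Qed.

Lemma notin_verts (K : complex) v g : v \notin verts K -> g \in K -> v \notin g.
Proof. by move=> vK gK; apply/negP => vg; case/negP: vK; apply/in_verts; exists g. Qed.

Lemma simplex_bdP (A F : simplex) :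
  reflect (exists2 v, v \in A & F = A `\ v) (F \in simplex_bd A).
Proof. by apply: (iffP (imfsetP _ _ _ _)) => -[v vA ->]; exists v. Qed.

Lemma linkP (A : simplex) (K : complex) (B : simplex) :
  reflect (exists g, [/\ g \in K, A `<=` g & B = g `\` A]) (B \in link A K).
Proof.
apply: (iffP (imfsetP _ _ _ _)) => [[g /= + ->]|[g [gK Ag ->]]].
  by rewrite !inE /= => /andP[gK Ag]; exists g.
by exists g => //=; rewrite !inE /= gK.
Qed.

Lemma joinP (K L : complex) (B : simplex) :
  reflect (exists q p, [/\ q \in K, p \in L & B = q `|` p]) (B \in join K L).
Proof.
apply: (iffP (imfset2P _ _ _ _ _)) => [[q qK [p pL ->]]|[q [p [qK pL ->]]]].
  by exists q, p.
by exists q => //; exists p.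
Qed.

Lemma stellar_subP (A : simplex) a K h :
  reflect ((exists g v, [/\ g \in K, A `<=` g, v \in A & h = a |` (g `\ v)]) \/
           (h \in K /\ ~~ (A `<=` h)))
          (h \in stellar_sub A a K).
Proof.
have eqg g v : A `<=` g -> v \in A -> (A `\ v) `|` (g `\` A) = g `\ v.
  move=> /fsubsetP Ag vA; apply/fsetP => z; rewrite !inE.
  by case: (z =P v) => [->|_] /=; rewrite ?vA //; case: (boolP (z \in A)) => //= /Ag ->.
rewrite inE; apply: (iffP orP).
  case=> [/joinP[q [p [+ /joinP[r [s [/simplex_bdP[v vA ->] /linkP[g [gK Ag ->]] ->]]] ->]]]|].
    by rewrite inE => /eqP ->; left; exists g, v; rewrite eqg.
  by rewrite !inE => /andP[hK hA]; right.
case=> [[g [v [gK Ag vA ->]]]|[hK hA]]; last by right; rewrite !inE hK.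
left; apply/joinP; exists [fset a], (g `\ v); split=> //; first by rewrite inE.
apply/joinP; exists (A `\ v), (g `\` A); rewrite eqg //.
by split=> //; [apply/simplex_bdP; exists v | apply/linkP; exists g].
Qed.

(** The generators created by subdividing [L] at [A] are those of the star of
    [a] in [K], because [B] has no vertex in [A] and because [a], which cannot
    lie in its own link, is neither in [A] nor in [B]. *)
Lemma weld_subdivision K L : weld K L -> subdivision L K.
Proof.
move=> [A [a [B [[A0 aK AK] [BK AB lkE LE]]]]].
have dAB b : b \in B -> [disjoint A & b].
  move=> bB; apply/fdisjointP => v vA; apply/negP => vb.
  have vVA : v \in verts [fset A] by apply/in_verts; exists A; rewrite ?inE.
  by move/fdisjointP: AB => /(_ _ vVA)/negP; apply; apply/in_verts; exists b.
have lk_notin h : h \in link [fset a] K -> a \notin h.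
  by move=> /linkP[g [_ _ ->]]; rewrite !inE eqxx.
have [v0 v0A] := fset0Pn _ A0.
have [g0 g0K ag0] := in_verts _ _ aK.
have [b0 b0B] : exists b, b \in B.
  have : g0 `\` [fset a] \in link [fset a] K.
    by apply/linkP; exists g0; rewrite fsub1set.
  by rewrite lkE => /joinP[q [b [_ bB _]]]; exists b.
have aB b : b \in B -> a \notin b.
  move=> bB; have : (A `\ v0) `|` b \in link [fset a] K.
    rewrite lkE; apply/joinP; exists (A `\ v0), b; split=> //.
    by apply/simplex_bdP; exists v0.
  by move=> /lk_notin; rewrite inE negb_or => /andP[].
have aA : a \notin A.
  apply/negP => aA.
  have faces v : v \in A -> v = a.
    move=> vA; apply/eqP; rewrite -[_ == _]negbK; apply/negP => nva.
    have : (A `\ v) `|` b0 \in link [fset a] K.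
      rewrite lkE; apply/joinP; exists (A `\ v), b0; split=> //.
      by apply/simplex_bdP; exists v.
    by move=> /lk_notin; rewrite !inE eq_sym nva aA.
  apply: AK; exists g0 => //; apply/fsubsetP => v /faces -> //.
have inA h : h \in join [fset A] B -> A `<=` h.
  by move=> /joinP[q [b [+ _ ->]]]; rewrite inE => /eqP->; exact: fsubsetUl.
exists A, a; split=> //.
- exists (A `|` b0); last exact: fsubsetUl.
  by rewrite LE inE; apply/orP; left; apply/joinP; exists A, b0; rewrite inE.
- apply/negP => /in_verts[g]; rewrite LE inE => /orP[/joinP[q [b [+ bB ->]]]|].
    by rewrite inE => /eqP ->; rewrite inE (negPf aA) (negPf (aB _ bB)).
  by rewrite !inE /= fsub1set => /andP[_ /negPf ->].
apply/fsetP => h; apply/idP/stellar_subP.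
  move=> hK; case: (boolP (a \in h)) => ah.
    have : h `\ a \in link [fset a] K by apply/linkP; exists h; rewrite fsub1set.
    rewrite lkE => /joinP[q [b [/simplex_bdP[v vA ->] bB hE]]].
    left; exists (A `|` b), v; split=> //; last 1 first.
    - rewrite -{1}(fsetD1K ah) hE; congr (_ |` _); apply/fsetP => z; rewrite !inE.
      case: (z =P v) => //= ->; apply/negbTE.
      by move/fdisjointP: (dAB _ bB); apply.
    - by rewrite LE inE; apply/orP; left; apply/joinP; exists A, b; rewrite inE.
    exact: fsubsetUl.
  right; rewrite LE !inE hK /= fsub1set ah orbT; split=> //.
  by apply/negP => Ah; apply: AK; exists h.
move=> [[g [v [gL Ag vA ->]]]|[hL Ah]]; last first.
  move: hL; rewrite LE inE => /orP[/inA|]; first by rewrite (negPf Ah).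
  by rewrite !inE => /andP[].
have {gL} /joinP[q [b [+ bB gE]]] : g \in join [fset A] B.
  move: gL; rewrite LE inE => /orP[] //.
  by rewrite !inE => /andP[gK _]; case: AK; exists g.
rewrite inE => /eqP qA; rewrite {q}qA in gE.
have : (A `\ v) `|` b \in link [fset a] K.
  by rewrite lkE; apply/joinP; exists (A `\ v), b; split=> //; apply/simplex_bdP; exists v.
move=> /linkP[k [kK ak kE]].
suff -> : a |` (g `\ v) = k by [].
have -> : g `\ v = k `\ a.
  rewrite -kE gE; apply/fsetP => z; rewrite !inE.
  case: (z =P v) => //= ->; apply/esym/negbTE.
  by move/fdisjointP: (dAB _ bB); apply.
by apply: fsetD1K; rewrite -fsub1set.
Qed.

Definition relabel (f : int -> int) (K : complex) : complex :=
  [fset [fset f v | v in (g : simplex)] | g in K].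

(** A property transported backwards by a stellar equivalence need only be
    invariant under subdivision, in both directions, and reflected by
    relabelling: a weld is the inverse of a subdivision. *)
Lemma stellar_equiv_ind (P : complex -> Prop) :
  (forall K A a, A != fset0 -> a \notin verts K ->
     P K <-> P (stellar_sub A a K)) ->
  (forall K f, {in verts K &, injective f} -> P (relabel f K) -> P K) ->
  forall K L, stellar_equiv K L -> P L -> P K.
Proof.
move=> subP relP K L; elim=> {K L} [K L|//|K L N _ IH1 _ IH2 /IH2/IH1 //].
case.
- by move=> [A [a [A0 _ aK ->]]]; exact: (proj2 (subP _ _ _ A0 aK)).
- by move=> /weld_subdivision [A [a [A0 _ aL ->]]]; exact: (proj1 (subP _ _ _ A0 aL)).
- by move=> [f [finj ->]]; apply: relP.
Qed.

(** * Two stellar invariants *)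

Definition coface (K : complex) (F : simplex) (x : int) : Prop :=
  x \notin F /\ x |` F \in K.

(** Every facet lies in at most two generators. No dimension is mentioned, so
    that the definition makes sense along any sequence of stellar moves. *)
Definition thin (K : complex) : Prop :=
  forall F x y z, coface K F x -> coface K F y -> coface K F z ->
    [\/ x = y, x = z | y = z].

(** Strong connectedness of the dual graph, stated through two-colourings:
    this is how it is used, and it avoids handling chains of generators. *)
Definition chained (K : complex) : Prop :=
  forall c : simplex -> bool,
    (forall F x y, coface K F x -> coface K F y -> c (x |` F) = c (y |` F)) ->
    forall g h, g \in K -> h \in K -> c g = c h.

(** Cofaces are either mapped injectively to cofaces of a single face of [K],
    or confined to two vertices by the shape of the face. *)
Lemma thin_transfer (K L : complex) :
  (forall F, (exists F' (h : int -> int),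
      (forall x, coface L F x -> coface K F' (h x)) /\
      (forall x y, coface L F x -> coface L F y -> h x = h y -> x = y)) \/
     (exists u v, forall x, coface L F x -> x = u \/ x = v)) ->
  thin K -> thin L.
Proof.
move=> tr tK F x y z cx cy cz; case: (tr F) => [[F' [h [hc hi]]]|[u [v uv]]].
  have [] := tK _ _ _ _ (hc _ cx) (hc _ cy) (hc _ cz).
  - by move/(hi _ _ cx cy); constructor 1.
  - by move/(hi _ _ cx cz); constructor 2.
  - by move/(hi _ _ cy cz); constructor 3.
by case: (uv _ cx) => ->; case: (uv _ cy) => ->; case: (uv _ cz) => ->;
  (try by constructor 1); (try by constructor 2); constructor 3.
Qed.

Lemma fsubU1 (A F : simplex) x y : x != y -> A `<=` x |` F -> A `<=` y |` F -> A `<=` F.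
Proof.
move=> nxy /fsubsetP Ax /fsubsetP Ay; apply/fsubsetP => z zA.
move: (Ax _ zA) (Ay _ zA); rewrite !inE; case: (z =P x) => //= ->.
by rewrite (negPf nxy).
Qed.

Lemma fsubU1_in (A F : simplex) x : A `<=` x |` F -> ~~ (A `<=` F) -> x \in A.
Proof.
move=> /fsubsetP Ax; apply: contraR => xA; apply/fsubsetP => z zA.
by move: (Ax _ zA); rewrite !inE; case: (z =P x) => //= zx; rewrite -zx zA in xA.
Qed.

Section Subdivision.
Variables (K : complex) (A : simplex) (a : int).
Hypotheses (A0 : A != fset0) (aK : a \notin verts K).
Let L := stellar_sub A a K.

(** The next three lemmas describe the cofaces in the subdivision: a coface
    [a] of [F] stands for the missing vertex of [A], the other cofaces of a
    face without [a] are old, and the face opposite to [x] in a generator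
    through [a] is completed by the unique vertex of [A] left out. *)
Lemma coface_sub_new F : a \notin F -> coface L F a ->
  exists v, [/\ v \in A, coface K F v & A `<=` v |` F].
Proof.
move=> aF [_ /stellar_subP[[g [v [gK Ag vA E]]]|[gK _]]]; last first.
  by have := notin_verts aK gK; rewrite !inE eqxx.
have ag : a \notin g `\ v.
  by apply: contra (notin_verts aK gK); rewrite inE => /andP[].
have FE : F = g `\ v by rewrite -(fsetU1K aF) E fsetU1K.
have vg : v \in g by move/fsubsetP: Ag; apply.
by exists v; rewrite /coface FE !inE eqxx /= fsetD1K.
Qed.

Lemma coface_sub_old F x : a \notin F -> x != a -> coface L F x ->
  coface K F x /\ ~~ (A `<=` x |` F).
Proof.
move=> aF xa [xF /stellar_subP[[g [v [gK Ag vA E]]]|[gK Ax]]] //.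
by have := fset1U1 a (g `\ v); rewrite -E !inE eq_sym (negPf xa) (negPf aF).
Qed.

Lemma coface_sub_apex G x : a \notin G -> coface L (a |` G) x ->
  exists v, [/\ v \in A, v \notin x |` G, A `<=` v |` (x |` G),
                v |` (x |` G) \in K & x \notin G].
Proof.
move=> aG [xF /stellar_subP[[g [v [gK Ag vA E]]]|[gK _]]]; last first.
  by have := notin_verts aK gK; rewrite !inE eqxx orbT.
have [xa xG] : x != a /\ x \notin G by move: xF; rewrite !inE negb_or => /andP[].
have ag := notin_verts aK gK.
have E' : x |` G = g `\ v.
  apply/fsetP => z; move/fsetP: E => /(_ z); rewrite !inE.
  case: (z =P a) => //= -> _.
  by rewrite eq_sym (negPf xa) (negPf aG) (negPf ag) andbF.
have vg : v \in g by move/fsubsetP: Ag; apply.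
by exists v; rewrite E' !inE eqxx fsetD1K.
Qed.

Lemma coface_sub_intro_apex g v x : g \in K -> A `<=` g -> v \in A ->
  x \in g -> x != v -> coface L (a |` (g `\ v `\ x)) x.
Proof.
move=> gK Ag vA xg xv; split.
  rewrite !inE eqxx /= orbF; apply: contraNneq (notin_verts aK gK) => <- //.
apply/stellar_subP; left; exists g, v; split=> //.
apply/fsetP => z; rewrite !inE; case: (z =P x) => //= ->.
by rewrite xv xg /= orbT.
Qed.

Lemma coface_sub_intro_new F x : coface K F x -> x \in A -> A `<=` x |` F ->
  coface L F a.
Proof.
move=> [xF FK] xA Ax; have := notin_verts aK FK; rewrite !inE negb_or => /andP[_ aF].
split=> //; apply/stellar_subP; left; exists (x |` F), x; split=> //.
by rewrite fsetU1K.
Qed.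

Lemma coface_sub_intro_old F x : coface K F x -> ~~ (A `<=` x |` F) -> coface L F x.
Proof. by move=> [xF FK] Ax; split=> //; apply/stellar_subP; right. Qed.

(** For a face [a |` G] everything depends on the number of vertices of [A]
    missing from [G]: if there is one, [v1], the cofaces are those of
    [v1 |` G] in [K]; if there are two, they are the only cofaces. *)
Lemma thin_sub : thin K -> thin L.
Proof.
apply: thin_transfer => F; case: (boolP (a \in F)) => aF; last first.
  have [u uP] : exists u, A `\` F != fset0 -> u \in A `\` F.
    by case: (fset_0Vmem (A `\` F)) => [->|[u uAF]]; [exists a; rewrite eqxx | exists u].
  left; pose h x := if x == a then u else x.
  have ha : coface L F a -> [/\ coface K F (h a) & A `<=` h a |` F].
    move=> /(coface_sub_new aF) [v [vA vF Av]].
    have : h a \in A `\` F.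
      rewrite /h eqxx; apply: uP; apply/fset0Pn; exists v.
      by rewrite !inE vA; case: vF => ->.
    rewrite !inE => /andP[hF hA].
    suff -> : h a = v by [].
    by move/fsubsetP: Av => /(_ _ hA); rewrite !inE (negPf hF) orbF => /eqP.
  exists F, h; split.
    move=> x; have [->|xa] := eqVneq x a; first by move/ha => -[].
    by rewrite /h (negPf xa) => /(coface_sub_old aF xa) [].
  have key x : coface L F a -> coface L F x -> x != a -> h a = h x -> False.
    move=> /ha[_ Aa] cx xa; have [_] := coface_sub_old aF xa cx.
    by rewrite [h x]/h (negPf xa) => /negP Ax E; rewrite E in Aa.
  move=> x y cx cy; have [xa|xa] := eqVneq x a; have [ya|ya] := eqVneq y a.
  - by rewrite xa ya.
  - by subst x => E; case: (key y).
  - by subst y => E; case: (key x).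
  - by rewrite /h (negPf xa) (negPf ya).
have [G FE aG] : exists2 G, F = a |` G & a \notin G.
  by exists (F `\ a); rewrite ?fsetD1K ?inE ?eqxx.
case: (fset_0Vmem (A `\` G)) => [AG|[v1 v1A]].
  right; exists a, a => x; rewrite FE => /(coface_sub_apex aG)[v [vA vG _ _ _]].
  have : v \in A `\` G by rewrite !inE vA andbT; apply: contra vG => vG; rewrite inE vG orbT.
  by rewrite AG inE.
case: (fset_0Vmem (A `\` G `\ v1)) => [AG|[v2 v2A]].
  left; exists (v1 |` G), id; split=> // x; rewrite FE.
  move=> /(coface_sub_apex aG)[v [vA vG Av vK xG]].
  have vv : v = v1.
    apply/eqP; rewrite -[_ == _]negbK; apply/negP => nv.
    have : v \in A `\` G `\ v1.
      by rewrite !inE nv vA andbT /=; apply: contra vG => vG; rewrite inE vG orbT.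
    by rewrite AG inE.
  subst v1; split.
    rewrite inE negb_or xG andbT inE; apply: contraNneq vG => <-; exact: fset1U1.
  by rewrite fsetUCA.
right; exists v1, v2 => x; rewrite FE => /(coface_sub_apex aG)[v [vA vG Av vK xG]].
move: v1A v2A; rewrite !inE => /andP[v1G v1A] /and3P[n12 v2G v2A].
move/fsubsetP: Av => Av; move: (Av _ v1A) (Av _ v2A).
rewrite !inE (negPf v1G) (negPf v2G) !orbF.
case/orP=> [/eqP v1v|/eqP ->]; last by left.
case/orP=> [/eqP v2v|/eqP ->]; last by right.
by rewrite v1v v2v eqxx in n12.
Qed.

Lemma thin_unsub : thin L -> thin K.
Proof.
apply: thin_transfer => F; left.
case: (boolP (A `<=` F)) => AF; last first.
  exists F, (fun x => if A `<=` x |` F then a else x); split.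
    move=> x cx; case: ifP => [Ax|/negbT Ax].
      by apply: (coface_sub_intro_new cx) => //; apply: fsubU1_in Ax AF.
    exact: coface_sub_intro_old.
  have an x : coface K F x -> a != x.
    move=> [_ xK]; have := notin_verts aK xK.
    by rewrite !inE negb_or => /andP[].
  move=> x y cx cy; case: ifP => Ax; case: ifP => Ay //.
  - move=> _; apply/eqP; rewrite -[_ == _]negbK; apply/negP => nxy.
    by case/negP: AF; exact: fsubU1 nxy Ax Ay.
  - by move=> E; have := an _ cy; rewrite E eqxx.
  - by move=> E; have := an _ cx; rewrite E eqxx.
have [v0 v0A] := fset0Pn _ A0.
have v0F : v0 \in F by move/fsubsetP: AF; apply.
exists (a |` (F `\ v0)), id; split=> // x [xF xK].
have -> : F `\ v0 = (x |` F) `\ v0 `\ x.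
  apply/fsetP => z; rewrite !inE; case: (z =P x) => //= ->.
  by rewrite (negPf xF) andbF.
apply: coface_sub_intro_apex => //.
- by apply: fsubset_trans AF _; exact: fsubsetUr.
- exact: fset1U1.
- by apply: contraNneq xF => ->.
Qed.

(** A colouring of the subdivision constant on adjacent generators takes one
    value on the pieces of a given generator of [K], which are pairwise
    adjacent, and so descends to [K]. *)
Lemma chained_sub : chained K -> chained L.
Proof.
move=> cK c cL g h gL hL; have [v0 v0A] := fset0Pn _ A0.
pose d g := if A `<=` g then c (a |` (g `\ v0)) else c g.
have star k v : k \in K -> A `<=` k -> v \in A -> c (a |` (k `\ v)) = d k.
  move=> gK Ag vA; rewrite /d Ag; have [->//|nv] := eqVneq v v0.
  have [vg v0g] : v \in k /\ v0 \in k by split; move/fsubsetP: Ag; apply.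
  have nv' : v0 != v by rewrite eq_sym.
  have := coface_sub_intro_apex gK Ag v0A vg nv.
  have := coface_sub_intro_apex gK Ag vA v0g nv'.
  have e : k `\ v0 `\ v = k `\ v `\ v0 by rewrite !fsetDDl fsetUC.
  rewrite e => c2 c1; have := cL _ _ _ c2 c1; rewrite ![_ |` (a |` _)]fsetUCA -{2}e.
  by rewrite !fsetD1K // !inE ?nv ?nv' ?vg ?v0g.
have dadj : forall F x y, coface K F x -> coface K F y -> d (x |` F) = d (y |` F).
  have mixed F x y : coface K F x -> coface K F y -> A `<=` x |` F ->
      ~~ (A `<=` y |` F) -> d (x |` F) = d (y |` F).
    move=> cx cy Ax Ay; have xA : x \in A.
      apply: (fsubU1_in Ax); apply: contra Ay => AF.
      by apply: fsubset_trans AF _; exact: fsubsetUr.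
    rewrite -(star _ x) ?(proj2 cx) // [d (y |` F)]/d (negPf Ay) fsetU1K ?(proj1 cx) //.
    by apply: cL; [exact: (coface_sub_intro_new cx)|exact: coface_sub_intro_old].
  move=> F x y cx cy.
  case: (boolP (A `<=` x |` F)) => Ax; case: (boolP (A `<=` y |` F)) => Ay.
  - have [->//|nxy] := eqVneq x y.
    have AF := fsubU1 nxy Ax Ay.
    have v0F : v0 \in F by move/fsubsetP: AF; apply.
    have E z : coface K F z -> z \notin F `\ v0 /\ coface L (a |` (F `\ v0)) z /\ a |` ((z |` F) `\ v0) = z |` (a |` (F `\ v0)).
      move=> [zF zK].
      have zv : z != v0 by apply: contraNneq zF => ->.
      have e : F `\ v0 = (z |` F) `\ v0 `\ z.
        apply/fsetP => t; rewrite !inE; case: (t =P z) => //= ->.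
        by rewrite (negPf zF) andbF.
      split; first by rewrite inE (negPf zF) andbF.
      split; last first.
        apply/fsetP => t; rewrite !inE; case: (t =P a) => [->|_] /=; first by rewrite orbT.
        by case: (t =P z) => //= ->; rewrite zv.
      rewrite e; apply: coface_sub_intro_apex => //; last exact: fset1U1.
      by apply: fsubset_trans AF _; exact: fsubsetUr.
    have [_ [c1 e1]] := E _ cx; have [_ [c2 e2]] := E _ cy.
    by rewrite /d Ax Ay e1 e2; apply: cL.
  - exact: mixed.
  - by apply/esym; exact: mixed.
  - by rewrite /d (negPf Ax) (negPf Ay); apply: cL; exact: coface_sub_intro_old.
have rep g' : g' \in L -> exists2 k, k \in K & c g' = d k.
  move=> /stellar_subP[[k [v [kK Ak vA ->]]]|[kK Ak]].
    by exists k; rewrite ?star.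
  by exists g'; rewrite // /d (negPf Ak).
have [k kK ->] := rep _ gL; have [k' kK' ->] := rep _ hL.
exact: cK.
Qed.

(** A colouring of [K] is lifted to the subdivision: adjacent pieces come
    from equal or adjacent generators. The parent of a piece [h] through [a]
    is recovered as [A `|` (h `\ a)]. *)
Lemma chained_unsub : chained L -> chained K.
Proof.
move=> cL c cK.
pose d h := if a \in h then c (A `|` (h `\ a)) else c h.
have star g v : g \in K -> A `<=` g -> v \in A -> d (a |` (g `\ v)) = c g.
  move=> gK Ag vA; rewrite /d fset1U1; congr c; apply/fsetP => z.
  have [/fsubsetP As an] := (Ag, notin_verts aK gK); rewrite !inE.
  case: (boolP (z \in A)) => [/As ->//|zA] /=.
  case: (z =P a) => [->|_] /=; first by rewrite (negPf an).
  by case: (z =P v) => //= zv; rewrite zv vA in zA.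
have old g : g \in K -> d g = c g by move=> gK; rewrite /d (negPf (notin_verts aK gK)).
have dadj : forall F x y, coface L F x -> coface L F y -> d (x |` F) = d (y |` F).
  move=> F x y cx cy; have [->//|nxy] := eqVneq x y.
  case: (boolP (a \in F)) => aF.
    have [G FE aG] : exists2 G, F = a |` G & a \notin G.
      by exists (F `\ a); rewrite ?fsetD1K ?inE ?eqxx.
    subst F.
    have [v [vA vG Av vK xG]] := coface_sub_apex aG cx.
    have [w [wA wG Aw wK yG]] := coface_sub_apex aG cy.
    have E z u : u \in A -> u \notin z |` G -> A `<=` u |` (z |` G) ->
        u |` (z |` G) \in K -> d (z |` (a |` G)) = c (u |` (z |` G)).
      move=> uA uG Au uK; rewrite -(star _ u) // fsetU1K //.
      by rewrite fsetUCA.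
    rewrite (E _ v) // (E _ w) //.
    move: (vG) (wG); rewrite !inE !negb_or => /andP[vx vG'] /andP[wy wG'].
    have inA u z t : t \in A -> A `<=` u |` (z |` G) -> t \notin G -> t = u \/ t = z.
      move=> tA /fsubsetP /(_ _ tA) + tG; rewrite !inE (negPf tG) orbF.
      by case/orP => /eqP; [left|right].
    case: (inA _ _ _ vA Aw vG') => [vw|vy]; last first.
      case: (inA _ _ _ wA Av wG') => [wv|wx]; first by rewrite wv vy eqxx in wy.
      by rewrite vy wx fsetUCA.
    subst w; rewrite ![v |` (_ |` G)]fsetUCA; apply: cK; split.
    - by rewrite !inE negb_or xG eq_sym vx.
    - by rewrite fsetUCA.
    - by rewrite !inE negb_or yG eq_sym wy.
    - by rewrite fsetUCA.
  have mixed z : coface L F a -> z != a -> coface L F z -> d (a |` F) = d (z |` F).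
    move=> ca za cz; have [v [vA cv Av]] := coface_sub_new aF ca.
    have [cz' _] := coface_sub_old aF za cz.
    rewrite (old (z |` F)) ?(proj2 cz') //.
    have -> : d (a |` F) = c (v |` F).
      by rewrite -(star _ v) ?(proj2 cv) // fsetU1K ?(proj1 cv).
    exact: cK.
  have [xa|xa] := eqVneq x a; first by subst x; apply: mixed => //; rewrite eq_sym.
  have [ya|ya] := eqVneq y a; first by subst y; apply/esym; apply: mixed.
  have [cx' _] := coface_sub_old aF xa cx; have [cy' _] := coface_sub_old aF ya cy.
  by rewrite !old ?(proj2 cx') ?(proj2 cy') //; exact: cK.
have rep g : g \in K -> exists2 k, k \in L & c g = d k.
  move=> gK; case: (boolP (A `<=` g)) => Ag.
    have [v0 v0A] := fset0Pn _ A0.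
    exists (a |` (g `\ v0)); last by rewrite star.
    by apply/stellar_subP; left; exists g, v0.
  by exists g; [apply/stellar_subP; right | rewrite old].
move=> g h /rep[k kL ->] /rep[k' kL' ->].
exact: cL.
Qed.

End Subdivision.

(** * Images of simplexes, relabelling, balls and spheres *)

Definition im (f : int -> int) (F : simplex) : simplex := [fset f v | v in F].

Lemma imP (f : int -> int) (F : simplex) y :
  reflect (exists2 v, v \in F & y = f v) (y \in im f F).
Proof. by apply: (iffP (imfsetP _ _ _ _)) => -[v vF ->]; exists v. Qed.

Lemma mem_im f (F : simplex) v : v \in F -> f v \in im f F.
Proof. by move=> vF; apply/imP; exists v. Qed.

Lemma imS f (F G : simplex) : F `<=` G -> im f F `<=` im f G.
Proof. by move=> /fsubsetP FG; apply/fsubsetP => _ /imP[v /FG vG ->]; exact: mem_im. Qed.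

Lemma im_U1 f x (F : simplex) : im f (x |` F) = f x |` im f F.
Proof.
apply/fsetP => y; apply/imP/idP => [[v + ->]|].
  by rewrite !inE => /orP[/eqP->|vF]; rewrite ?eqxx // mem_im ?orbT.
rewrite inE => /orP[|/imP[v vF ->]]; last by exists v => //; rewrite !inE vF orbT.
by rewrite inE => /eqP ->; exists x => //; exact: fset1U1.
Qed.

Lemma relabelP f K h : reflect (exists2 g, g \in K & h = im f g) (h \in relabel f K).
Proof. by apply: (iffP (imfsetP _ _ _ _)) => -[v vF ->]; exists v. Qed.

Lemma coface_verts K F x : coface K F x -> x \in verts K.
Proof. by move=> [_ xK]; apply/in_verts; exists (x |` F); rewrite ?fset1U1. Qed.

Lemma coface_face_verts K F x v : coface K F x -> v \in F -> v \in verts K.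
Proof. by move=> [_ xK] vF; apply/in_verts; exists (x |` F); rewrite // inE vF orbT. Qed.

Section Relabel.
Variables (K : complex) (f : int -> int).
Hypothesis finj : {in verts K &, injective f}.

Lemma thin_relabel : thin (relabel f K) -> thin K.
Proof.
apply: thin_transfer => F; left; exists (im f F), f; split.
  move=> x cx; split; last first.
    by rewrite -im_U1; apply/relabelP; exists (x |` F); rewrite ?(proj2 cx).
  apply/imP => -[v vF /finj xv]; move: (proj1 cx).
  by rewrite xv ?vF // ?(coface_verts cx) // (coface_face_verts cx).
by move=> x y cx cy; apply: finj; [exact: coface_verts cx | exact: coface_verts cy].
Qed.

Lemma chained_relabel : chained (relabel f K) -> chained K.
Proof.
move=> cL c cK.
pose pre (h : simplex) : simplex := [fset v in verts K | f v \in h].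
have in_pre v (h : simplex) : (v \in pre h) = (v \in verts K) && (f v \in h).
  by rewrite !inE.
have pre_im g : g \in K -> pre (im f g) = g.
  move=> gK; apply/fsetP => v; rewrite in_pre; apply/andP/idP.
    case=> vK /imP[w wg /finj]; move=> -> //; apply/in_verts; exists g => //.
  by move=> vg; rewrite mem_im //; split=> //; apply/in_verts; exists g.
have adj F x : coface (relabel f K) F x ->
    exists x0, coface K (pre F) x0 /\ pre (x |` F) = x0 |` pre F.
  move=> [xF /relabelP[g gK E]].
  have /imP[x0 x0g xE] : x \in im f g by rewrite -E fset1U1.
  have x0K : x0 \in verts K by apply/in_verts; exists g.
  have e : pre (x |` F) = x0 |` pre F.
    apply/fsetP => v; rewrite in_pre !inE; case: (v =P x0) => [->|nv] /=.
      by rewrite x0K xE eqxx.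
    case: (boolP (v \in verts K)) => //= vK; case: eqP => //=.
    by rewrite xE => /finj - /(_ vK x0K).
  exists x0; split=> //; split; last by rewrite -e E pre_im.
  by rewrite in_pre -xE (negPf xF) andbF.
have dadj F x y : coface (relabel f K) F x -> coface (relabel f K) F y ->
    c (pre (x |` F)) = c (pre (y |` F)).
  by move=> /adj[x0 [cx ->]] /adj[y0 [cy ->]]; exact: cK.
move=> g h gK hK; rewrite -(pre_im _ gK) -(pre_im _ hK).
by apply: (cL (c \o pre)) => //; apply/relabelP; [exists g|exists h].
Qed.
End Relabel.

Lemma thin_stellar K L : stellar_equiv K L -> thin L -> thin K.
Proof.
apply: (stellar_equiv_ind (P := thin)) => [{}K A a A0 aK|{}K f]; last exact: thin_relabel.
split; [exact: (thin_sub aK) | exact: (thin_unsub A0 aK)].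
Qed.

Lemma chained_stellar K L : stellar_equiv K L -> chained L -> chained K.
Proof.
apply: (stellar_equiv_ind (P := chained)) => [{}K A a A0 aK|{}K f]; last exact: chained_relabel.
split; [exact: (chained_sub A0 aK) | exact: (chained_unsub A0 aK)].
Qed.

Lemma thin_simplex A : thin [fset A].
Proof.
move=> F x y z [xF xA] [yF yA] _; constructor 1.
have : x |` F = y |` F by move: xA yA; rewrite !inE => /eqP -> /eqP ->.
by move/fsetP/(_ x); rewrite !inE eqxx (negPf xF) /= orbF => /esym/eqP.
Qed.

Lemma chained_simplex A : chained [fset A].
Proof. by move=> c _ g h; rewrite !inE => /eqP-> /eqP->. Qed.

Lemma thin_simplex_bd A : thin (simplex_bd A).
Proof.
refine (@thin_transfer [fset A] _ _ (@thin_simplex A)) => F; right.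
have E x : coface (simplex_bd A) F x -> exists v, A `\` F `<=` [fset v; x] /\ x \in A `\` F.
  move=> [xF /simplex_bdP[v vA E]]; exists v.
  have h z : (z == x) || (z \in F) = (z != v) && (z \in A).
    by move/fsetP: E => /(_ z); rewrite !inE.
  split; last by rewrite !inE xF; have := h x; rewrite eqxx => /esym/andP[].
  apply/fsubsetP => z; rewrite !inE => /andP[zF zA].
  by have := h z; rewrite (negPf zF) zA andbT orbF; case: (z == v); case: (z == x).
case: (pselect (exists x, coface (simplex_bd A) F x)) => [[x cx]|no]; last first.
  by exists 0%R, 0%R => x cx; case: no; exists x.
have [v [/fsubsetP h _]] := E _ cx; exists v, x => y /E[_ [_ /h]].
by rewrite !inE => /orP[]/eqP; [left|right].
Qed.

Lemma chained_simplex_bd A : chained (simplex_bd A).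
Proof.
move=> c cA g h /simplex_bdP[v vA ->] /simplex_bdP[w wA ->].
have [->//|nvw] := eqVneq v w.
have E x y : x \in A -> y \in A -> x != y ->
    y |` (A `\ x `\ y) = A `\ x /\ coface (simplex_bd A) (A `\ x `\ y) y.
  move=> xA yA xy.
  have e : y |` (A `\ x `\ y) = A `\ x by rewrite fsetD1K // !inE eq_sym xy.
  split=> //; split; first by rewrite !inE eqxx.
  by rewrite e; apply/simplex_bdP; exists x.
have [e1 c1] := E _ _ vA wA nvw; rewrite eq_sym in nvw.
have [e2 c2] := E _ _ wA vA nvw.
rewrite -e1 -e2; have e : A `\ v `\ w = A `\ w `\ v by rewrite !fsetDDl fsetUC.
by rewrite e in c1 *; apply: cA.
Qed.

(** * Links, manifolds and connectedness *)

Lemma thin_link n M i : stellar_manifold n M -> i \in verts M -> thin (link [fset i] M).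
Proof.
move=> [_ /(_ i)] h /h[] /thin_stellar; apply; [exact: thin_simplex|exact: thin_simplex_bd].
Qed.

Lemma chained_link n M i : stellar_manifold n M -> i \in verts M -> chained (link [fset i] M).
Proof.
move=> [_ /(_ i)] h /h[] /chained_stellar; apply; [exact: chained_simplex|exact: chained_simplex_bd].
Qed.

Lemma coface_link M i F x : coface M (i |` F) x -> i \notin F ->
  coface (link [fset i] M) F x.
Proof.
move=> [xF xM] iF; split; first by apply: contra xF; rewrite !inE orbC => ->.
apply/linkP; exists (x |` (i |` F)); split=> //.
  by rewrite fsub1set !inE eqxx orbT.
apply/fsetP => z; rewrite !inE; case: (z =P i) => [->|] //=.
by move: xF; rewrite !inE negb_or eq_sym (negPf iF) => /andP[/negPf -> _].
Qed.

Lemma coface_unlink M i F x : coface (link [fset i] M) F x ->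
  i \notin x |` F /\ coface M (i |` F) x.
Proof.
move=> [xF /linkP[g [gM]]]; rewrite fsub1set => ig E.
have i_ : i \notin x |` F by rewrite E !inE eqxx.
split=> //; split; last by rewrite fsetUCA E fsetD1K.
by move: i_; rewrite !inE !negb_or eq_sym => /andP[-> _].
Qed.

Section Connectedness.
Local Open Scope ring_scope.

(** If generators of different colours were disjoint and both colours present,
    the sum of the barycentric coordinates at the vertices of the coloured
    generators would be a continuous function on the realization with the two
    values 0 and 1 only. *)
Lemma connected_color (R : realType) (M : complex) (c : simplex -> bool) :
  (forall g, g \in M -> g != fset0) ->
  connected (realization R M) ->
  (forall g h, g \in M -> h \in M -> c g -> ~~ c h -> [disjoint g & h]%fset) ->
  forall g h, g \in M -> h \in M -> c g = c h.
Proof.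
move=> ne conn sep.
suff main g h : g \in M -> h \in M -> c g -> ~~ c h -> False.
  move=> g h gM hM; case: (boolP (c g)) => cg; case: (boolP (c h)) => ch //.
    by case: (main g h).
  by case: (main h g).
move=> gM hM cg ch.
pose V := verts [fset k in M | c k]%fset.
pose phi (x : {ptws int -> R}) : R := \sum_(v <- V) x v.
have inV k : k \in M -> c k -> k `<=` V.
  move=> kM ck; apply/fsubsetP => v vk; apply/in_verts; exists k => //.
  by rewrite !inE kM.
have phi1 x k : k \in M -> c k -> (forall v, v \notin k -> x v = 0) ->
    phi x = \sum_(v <- k) x v.
  move=> kM ck x0; rewrite /phi; apply/esym/big_fset_incl; first exact: inV.
  by move=> v _ vk; exact: x0.
have phi0 x k : k \in M -> ~~ c k -> (forall v, v \notin k -> x v = 0) -> phi x = 0.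
  move=> kM ck x0; rewrite /phi big_seq big1 // => v /in_verts[l].
  rewrite !inE => /andP[lM cl] vl; apply: x0.
  by move/fdisjointP: (sep _ _ lM kM cl ck); apply.
have phic : continuous phi.
  apply: continuous_big => [|v _]; first exact: add_continuous.
  exact: (@proj_continuous int (fun=> R) v).
have pt k : k \in M -> exists x, realization R M x /\ (forall v, v \notin k -> x v = 0) /\ \sum_(v <- k) x v = 1.
  move=> kM; have [v0 v0k] := fset0Pn _ (ne _ kM).
  pose x (v : int) : R := (v == v0)%:R.
  have x0 v : v \notin k -> x v = 0.
    by rewrite /x; case: eqP => // ->; rewrite v0k.
  have x1 : \sum_(v <- k) x v = 1.
    rewrite (big_fsetD1 v0) //= {1}/x eqxx big_seq big1 ?addr0 // => v.
    by rewrite !inE /x => /andP[/negPf ->].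
  by exists x; split=> //; exists k.
have [x [xM [x0 x1]]] := pt _ gM; have [y [yM [y0 y1]]] := pt _ hM.
have : connected (phi @` realization R M)%classic.
  by apply: connected_continuous_connected => //; apply: continuous_subspaceT.
move=> /connected_intervalP/(_ 0 1).
have p0 : (phi @` realization R M)%classic 0 by exists y => //; rewrite (phi0 _ h).
have p1 : (phi @` realization R M)%classic 1 by exists x => //; rewrite (phi1 _ g).
move=> /(_ p0 p1 (1/2)) []; first by lra.
move=> z [k kM [_ z0 z1]]; case: (boolP (c k)) => ck.
  by rewrite (phi1 _ k) // z1; lra.
by rewrite (phi0 _ k) //; lra.
Qed.
End Connectedness.

Lemma coface_link_in M i F x : i \in F -> coface M F x -> coface (link [fset i] M) (F `\ i) x.
Proof.
by move=> iF cx; apply: coface_link; rewrite ?fsetD1K // !inE eqxx.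
Qed.

(** A facet with a vertex [i] is handled in the link of [i]. The empty facet
    occurs in dimension 0 only, where the link says nothing about [M] and
    connectedness leaves a single generator. *)
Lemma thin_manifold (R : realType) n M : stellar_manifold n M ->
  connected (realization R M) -> thin M.
Proof.
move=> mM conn F x y z cx cy cz; case: (fset_0Vmem F) => [F0|[i iF]].
  have card1 g : g \in M -> #|` g| = 1%N.
    move=> gM; rewrite (proj1 mM _ gM).
    by have := proj1 mM _ (proj2 cx); rewrite F0 fsetU0 cardfs1 => <-.
  constructor 1; have := @connected_color R M (fun g => g == [fset x]).
  move=> /(_ _ conn _ _ _ (proj2 cx) (proj2 cy)); rewrite F0 !fsetU0 eqxx.
  have E : [fset x] = [fset y] -> x = y.
    by move=> /fsetP/(_ x); rewrite !inE eqxx => /esym/eqP.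
  move=> H; apply: E; apply/esym/eqP; rewrite -H // => [g gM|g h gM hM /eqP -> hx].
    by rewrite -cardfs_gt0 card1.
  rewrite fdisjoint1X; have /eqP/cardfs1P[w hw] := card1 _ hM.
  by move: hx; rewrite hw; apply: contra; rewrite inE => /eqP ->.
have iM := coface_face_verts cx iF.
by apply: (thin_link mM iM); exact: (coface_link_in iF).
Qed.

(** The link of a vertex being strongly connected, a colour that does not
    change across nonempty facets is constant on stars of vertices, so that
    generators of different colours are disjoint. *)
Lemma manifold_adjacent (R : realType) n M (c : simplex -> bool) g0 h0 :
  stellar_manifold n M -> connected (realization R M) ->
  g0 \in M -> h0 \in M -> c g0 -> ~~ c h0 ->
  exists F x y, [/\ F != fset0, coface M F x, coface M F y, c (x |` F) & ~~ c (y |` F)].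
Proof.
move=> mM conn g0M h0M cg0 ch0; apply: contrapT => no.
have adj F x y : F != fset0 -> coface M F x -> coface M F y -> c (x |` F) = c (y |` F).
  move=> F0 cx cy; case: (boolP (c (x |` F))) => ccx; case: (boolP (c (y |` F))) => ccy //.
    by case: no; exists F, x, y.
  by case: no; exists F, y, x.
have star g h i : g \in M -> h \in M -> i \in g -> i \in h -> c g = c h.
  move=> gM hM ig ih; have iM : i \in verts M by apply/in_verts; exists g.
  have in_lk k : k \in M -> i \in k -> k `\ i \in link [fset i] M.
    by move=> kM ik; apply/linkP; exists k; rewrite fsub1set.
  have := chained_link mM iM (c := fun B => c (i |` B)).
  move=> /(_ _ _ _ (in_lk _ gM ig) (in_lk _ hM ih)); rewrite !fsetD1K //; apply.
  move=> F x y /coface_unlink [_ cx] /coface_unlink [_ cy].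
  rewrite ![i |` (_ |` F)]fsetUCA; apply: adj => //.
  by apply/fset0Pn; exists i; exact: fset1U1.
have : c g0 = c h0.
  apply: (connected_color _ conn) => // [g gM|g h gM hM cg ch].
    by rewrite -cardfs_gt0 (proj1 mM _ gM).
  apply/fdisjointP => i ig; apply/negP => ih; case/negP: ch.
  by rewrite -(star _ _ _ gM hM ig ih).
by rewrite cg0 (negPf ch0).
Qed.

(** * Presentations of generalized complexes *)

(** A face may be glued because of its labels alone only if it has no marked
    vertex. In the construction below the marked vertices are the apex and the
    auxiliary vertex of a subdivision. *)
Definition qglue (p : int -> int) (Z g h F : simplex) : bool :=
  (F `<=` im p g `&` im p h) && (~~ [disjoint F & Z]%fset ==> (F `<=` im p (g `&` h))).

Record realizes (K : gcomplex) (X : complex) (p : int -> int) (Z : simplex)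
    (psi : gidx K -> simplex) : Prop := Realizes {
  rz_inj : injective psi;
  rz_mem : forall i, psi i \in X;
  rz_surj : forall g, g \in X -> exists i, psi i = g;
  rz_vert : forall i, gvert i = im p (psi i);
  rz_glue : forall i j F, gglue i j F = qglue p Z (psi i) (psi j) F }.

(** What makes the presented object satisfy the axioms: [vd_mark] forces a
    marked label to have a single vertex above it, and [vd_free] prevents two
    unmarked generators from being glued all along. *)
Record valid (n : nat) (X : complex) (p : int -> int) (Z : simplex) : Prop := Valid {
  vd_unif : uniform n X;
  vd_inj : forall g, g \in X -> {in g &, injective p};
  vd_mark : forall x, x \in verts X -> p x \in Z -> p x = x;
  vd_free : forall g h, g \in X -> h \in X -> im p g = im p h ->
    [disjoint im p g & Z]%fset -> g = h }.

Lemma card_im p (g : simplex) : {in g &, injective p} -> #|` im p g| = #|` g|.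
Proof. by move=> pinj; apply: card_in_imfset. Qed.

Lemma im_D1 p (g : simplex) v : {in g &, injective p} -> v \in g ->
  im p (g `\ v) = im p g `\ p v.
Proof.
move=> pinj vg; apply/fsetP => y; rewrite !inE; apply/imP/andP.
  case=> z; rewrite !inE => /andP[zv zg] ->; split; last exact: mem_im.
  by apply: contraNneq zv => /pinj ->.
case=> yv /imP[z zg yz]; exists z => //; rewrite !inE zg andbT.
by apply: contraNneq yv => <-; rewrite yz.
Qed.

Lemma mem_im_inj p (g : simplex) (G : simplex) v : {in g &, injective p} -> v \in g ->
  G `<=` g -> (p v \in im p G) = (v \in G).
Proof.
move=> pinj vg /fsubsetP Gg; apply/imP/idP => [[w wG /pinj e]|vG]; last by exists v.
by rewrite e // Gg.
Qed.

(** A face of [g] comes from [g `&` h] when its vertices in [g], which are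
    determined by their labels, all belong to [h]. *)
Lemma im_capP p (g h : simplex) F : {in g &, injective p} -> F `<=` im p g ->
  reflect (forall v, v \in g -> p v \in F -> v \in h) (F `<=` im p (g `&` h)).
Proof.
move=> pinj /fsubsetP Fg; apply: (iffP (@fsubsetP _ _ _)) => [Fgh v vg /Fgh|vh y yF].
  by rewrite (mem_im_inj pinj vg) ?fsubsetIl // inE vg.
have /imP[v vg yv] := Fg _ yF; rewrite yv mem_im // inE vg vh //.
by rewrite -yv.
Qed.

Section Realizes.
Variables (n : nat) (K : gcomplex) (X : complex) (p : int -> int) (Z : simplex).
Variable psi : gidx K -> simplex.
Hypotheses (V : valid n X p Z) (rz : realizes X p Z psi).

Let pinj i : {in psi i &, injective p}.
Proof. by apply: (vd_inj V); exact: rz_mem rz i. Qed.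

Lemma realizes_axioms : gcomplex_axioms K.
Proof.
have Zvert i z : z \in psi i -> p z \in Z -> p z = z.
  by move=> zi; apply: (vd_mark V); apply/in_verts; exists (psi i) => //; exact: rz_mem rz i.
split.
- by move=> i j F; rewrite (rz_glue rz) !(rz_vert rz) => /andP[].
- move=> i F; rewrite (rz_glue rz) !(rz_vert rz) /qglue !fsetIid => ->.
  by rewrite implybT.
- by move=> i j F; rewrite !(rz_glue rz) /qglue fsetIC [psi j `&` _]fsetIC.
- move=> i j k F; rewrite !(rz_glue rz) /qglue !fsubsetI.
  move=> /andP[/andP[-> Fj] ij] /andP[/andP[_ ->] jk] /=.
  apply/implyP => FZ; move: ij jk; rewrite FZ /= => ij jk.
  apply/fsubsetP => y yF; move/fsubsetP: ij => /(_ _ yF) /imP[v].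
  rewrite inE => /andP[vi vj] yv; rewrite yv mem_im // inE vi /=.
  by apply: (im_capP _ (@pinj j) Fj jk) => //; rewrite -yv.
- move=> i j F G; rewrite !(rz_glue rz) /qglue => /andP[FV Fij] GF.
  rewrite (fsubset_trans GF FV) /=; apply/implyP => GZ.
  apply: (fsubset_trans GF); apply: (implyP Fij).
  by apply: contra GZ; exact: fdisjointWl.
- move=> i j F F1; rewrite (rz_glue rz) !(rz_vert rz) /qglue => FV; rewrite FV /=.
  apply/implyP => /fdisjointP FZ; apply/fsubsetP => y yF.
  have Fy : F = [fset y] :> {fset int}.
    by apply/esym/eqP; rewrite eqEfcard fsub1set yF cardfs1.
  have yZ : y \in Z.
    apply: contrapT => /negP yZ; apply: FZ => z.
    by rewrite Fy inE => /eqP ->.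
  move/fsubsetP: FV => /(_ _ yF); rewrite inE => /andP[/imP[v vi yv] /imP[w wj yw]].
  have vy : p v = v by apply: (Zvert i); rewrite // -yv.
  have wy : p w = w by apply: (Zvert j); rewrite // -yw.
  by apply/imP; exists v; rewrite // inE vi -vy -yv yw wy wj.
move=> i j; rewrite (rz_glue rz) (rz_vert rz) /qglue fsubsetI fsubset_refl /=.
have [iX jX] := (rz_mem rz i, rz_mem rz j).
have cc : #|` psi i| = #|` psi j| by rewrite !(vd_unif V).
move=> /andP[ij ijZ]; apply: (rz_inj rz); case: (boolP [disjoint im p (psi i) & Z]%fset) => iZ.
  apply: (vd_free V) => //; apply/eqP; rewrite eqEfcard ij.
  by rewrite leq_eqVlt !card_im ?cc ?eqxx //; exact: pinj.
apply/eqP; rewrite eqEfcard cc leqnn andbT; apply/fsubsetP => v vi.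
have := implyP ijZ iZ; move/(im_capP _ (@pinj i) (fsubset_refl _)).
by apply=> //; exact: mem_im.
Qed.
End Realizes.

Definition quot (X : complex) (p : int -> int) (Z : simplex) : gcomplex :=
  @GComplex X (fun g => im p (val g)) (fun g h F => qglue p Z (val g) (val h) F).

Lemma quot_realizes X p Z : @realizes (quot X p Z) X p Z (fun g => val g).
Proof.
split=> //.
  by move=> i; exact: valP.
by move=> g gX; exists [` gX].
Qed.

Lemma imS_inj f (W F G : simplex) : {in W &, injective f} -> F `<=` W -> G `<=` W ->
  (im f F `<=` im f G) = (F `<=` G).
Proof.
move=> finj FW GW; apply/idP/idP; last exact: imS.
move=> /fsubsetP FG; apply/fsubsetP => v vF.
have vW : v \in W by move/fsubsetP: FW; apply.
by rewrite -(mem_im_inj finj vW GW); apply: FG; exact: mem_im.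
Qed.

Lemma im_comp f p (g : simplex) : im (f \o p) g = im f (im p g).
Proof.
apply/fsetP => y; apply/imP/imP => [[v vg ->]|[_ /imP[v vg ->] ->]].
  by exists (p v) => //; exact: mem_im.
by exists v.
Qed.

Lemma eq_in_im f p (g : simplex) : {in g, f =1 p} -> im f g = im p g.
Proof.
move=> e; apply/fsetP => y; apply/imP/imP => -[v vg ->]; exists v => //; rewrite e //.
Qed.

(** A presentation determines the generalized complex up to the names of its
    generators, and changing the labels injectively is a renumbering. *)
Lemma realizes_renumbering K L X p p' Z psi psi' f :
  @realizes K X p Z psi -> @realizes L X p' Z psi' ->
  {in verts X, forall v, p' v = f (p v)} ->
  {in im p (verts X) &, injective f} ->
  {in im p (verts X), forall v, (f v \in Z) = (v \in Z)} ->
  grenumbering K L.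
Proof.
move=> rK rL pE finj fZ.
have ex i : exists j, psi' j == psi i.
  by have [j <-] := rz_surj rL (rz_mem rK i); exists j.
have ex' j : exists i, psi i == psi' j.
  by have [i <-] := rz_surj rK (rz_mem rL j); exists i.
pose phi i := xchoose (ex i); pose phi' j := xchoose (ex' j).
have phiE i : psi' (phi i) = psi i by apply/eqP; exact: (xchooseP (ex i)).
have phi'E j : psi (phi' j) = psi' j by apply/eqP; exact: (xchooseP (ex' j)).
have gW i : psi i `<=` verts X.
  by apply/fsubsetP => v vi; apply/in_verts; exists (psi i) => //; exact: rz_mem rK i.
have sub g : g `<=` verts X -> im p' g = im f (im p g).
  move=> /fsubsetP gX; rewrite -im_comp; apply: eq_in_im => v vg /=.
  by apply: pE; exact: gX.
exists phi, f; split.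
- exists phi' => i; first by apply: (rz_inj rK); rewrite phi'E phiE.
  by apply: (rz_inj rL); rewrite phiE phi'E.
- move=> i j v w; rewrite !(rz_vert rK) => vi wj; apply: finj.
    by move/fsubsetP: (imS p (gW i)); apply.
  by move/fsubsetP: (imS p (gW j)); apply.
- by move=> i; rewrite (rz_vert rL) (rz_vert rK) phiE sub.
move=> i j F; rewrite (rz_vert rK) (rz_glue rL) (rz_glue rK) !phiE => Fi.
have FW : F `<=` im p (verts X) by apply: fsubset_trans Fi _; exact: imS.
rewrite -/(im f F) /qglue !fsubsetI !sub //; last first.
  by apply: fsubset_trans (gW i); exact: fsubsetIl.
have S g : g `<=` verts X -> (im f F `<=` im f (im p g)) = (F `<=` im p g).
  by move=> gX; apply: imS_inj finj FW _; exact: imS.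
rewrite !S //; last by apply: fsubset_trans (gW i); exact: fsubsetIl.
congr (_ && (~~ _ ==> _)); apply/fdisjointP/fdisjointP => dF y.
  move=> yF; rewrite -fZ; first by apply: dF; exact: mem_im.
  by move/fsubsetP: FW; apply.
by move=> /imP[v vF ->]; rewrite fZ; [exact: dF | move/fsubsetP: FW; apply].
Qed.

Lemma renumbering_equiv n K L X p p' Z psi psi' f :
  valid n X p Z -> valid n X p' Z ->
  @realizes K X p Z psi -> @realizes L X p' Z psi' ->
  {in verts X, forall v, p' v = f (p v)} ->
  {in im p (verts X) &, injective f} ->
  {in im p (verts X), forall v, (f v \in Z) = (v \in Z)} ->
  gstellar_equiv K L.
Proof.
move=> vp vp' rK rL pE finj fZ; apply: rt_step; split.
- exact: realizes_axioms vp rK.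
- exact: realizes_axioms vp' rL.
by constructor 3; exact: realizes_renumbering rK rL pE finj fZ.
Qed.

Lemma realizes_equiv n K L X p Z psi psi' : valid n X p Z ->
  @realizes K X p Z psi -> @realizes L X p Z psi' -> gstellar_equiv K L.
Proof.
by move=> vp rK rL; apply: (renumbering_equiv (f := id) vp vp rK rL).
Qed.

(** The vertices of an unmarked generator matter only through their labels:
    [phi] may move such generators freely, but has to keep the intersections
    of the marked ones. *)
Lemma realizes_relift K X p Z psi X' p' (phi : simplex -> simplex) :
  @realizes K X p Z psi ->
  {in X &, injective phi} -> (forall g, g \in X -> phi g \in X') ->
  (forall g, g \in X' -> exists2 h, h \in X & phi h = g) ->
  (forall g, g \in X -> im p' (phi g) = im p g) ->
  (forall g h, g \in X -> h \in X -> ~~ [disjoint im p g & Z]%fset -> ~~ [disjoint im p h & Z]%fset ->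
     im p' (phi g `&` phi h) = im p (g `&` h)) ->
  @realizes K X' p' Z (phi \o psi).
Proof.
move=> rz phinj phiX phis phim phic; split.
- move=> i j /= /phinj e; apply: (rz_inj rz); apply: e; exact: rz_mem rz _.
- by move=> i /=; apply: phiX; exact: rz_mem rz _.
- by move=> g /phis[h /(rz_surj rz)[i <-] <-]; exists i.
- by move=> i /=; rewrite phim ?(rz_vert rz) //; exact: rz_mem rz _.
move=> i j F /=; have [iX jX] := (rz_mem rz i, rz_mem rz j).
rewrite (rz_glue rz) /qglue !phim // fsubsetI.
case: (boolP (F `<=` im p (psi i))) => //= Fi.
case: (boolP (F `<=` im p (psi j))) => //= Fj.
case: (boolP [disjoint F & Z]%fset) => //= FZ; rewrite phic //.
  by apply: contra FZ; exact: fdisjointWl.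
by apply: contra FZ; exact: fdisjointWl.
Qed.

(** * Subdividing a presentation *)

Lemma valid_sub n X p Z A b : valid n X p Z ->
  b \notin verts X -> b \notin im p (verts X) -> p b = b ->
  valid n (stellar_sub A b X) p (b |` Z).
Proof.
move=> V bX bpX pb.
have inj g v : g \in X -> {in b |` (g `\ v) &, injective p}.
  move=> gX x y; rewrite !inE.
  have np z : z \in g -> p z != b.
    move=> zg; apply: contraNneq bpX => <-; apply: mem_im.
    by apply/in_verts; exists g.
  case/orP=> [/eqP->|/andP[_ xg]]; case/orP=> [/eqP->|/andP[_ yg]] //; rewrite ?pb.
  - by move=> e; case/eqP: (np _ yg).
  - by move=> e; case/eqP: (np _ xg).
  - exact: vd_inj V _ gX _ _ xg yg.
split.
- move=> g /stellar_subP[[k [v [kX Ak vA ->]]]|[gX _]]; last exact: vd_unif V _ gX.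
  have vk : v \in k by move/fsubsetP: Ak; apply.
  have bk : b \notin k `\ v by rewrite inE negb_and (notin_verts bX kX) orbT.
  by rewrite cardfsU1 bk -(vd_unif V kX) (cardfsD1 v k) vk.
- move=> g /stellar_subP[[k [v [kX Ak vA ->]]]|[gX _]]; last exact: vd_inj V _ gX.
  exact: inj.
- have old x : x \in verts X -> p x \in b |` Z -> p x = x.
    move=> xX; rewrite !inE => /orP[/eqP e|]; last exact: vd_mark V _ xX.
    by case/negP: bpX; rewrite -e mem_im.
  move=> x /in_verts[g /stellar_subP[[k [v [kX Ak vA ->]]]|[gX _]]].
    rewrite !inE => /orP[/eqP -> //|/andP[_ xk]]; rewrite -in_fset1U; apply: old.
    by apply/in_verts; exists k.
  by move=> xg; apply: old; apply/in_verts; exists g.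
move=> g h gL hL e gZ.
have old k : k \in stellar_sub A b X -> [disjoint im p k & b |` Z]%fset -> k \in X.
  move=> /stellar_subP[[k' [v [kX Ak vA ->]]]|[gX _] //].
  move=> /fdisjointP/(_ b); rewrite im_U1 pb !inE eqxx => /(_ isT) //.
have gX := old _ gL gZ; have hX : h \in X by apply: old => //; rewrite -e.
apply: (vd_free V) => //; apply: fdisjointWr gZ; exact: fsubsetUr.
Qed.

Section GSub.
Variables (n : nat) (K : gcomplex) (X : complex) (p : int -> int) (Z : simplex).
Variable psi : gidx K -> simplex.
Hypotheses (V : valid n X p Z) (rz : realizes X p Z psi).
Variables (A g0 : simplex) (b : int).
Hypotheses (A0 : A != fset0) (g0X : g0 \in X) (Ag0 : A `<=` g0).
Hypotheses (bX : b \notin verts X) (bpX : b \notin im p (verts X)) (pb : p b = b).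
Hypothesis star_cond : ~~ [disjoint im p A & Z]%fset \/
  (forall h, h \in X -> im p A `<=` im p h -> A `<=` h) /\
  (forall g h, g \in X -> h \in X -> A `<=` g -> A `<=` h ->
     im p g `&` im p h `<=` im p (g `&` h)).

Let pinj i : {in psi i &, injective p}.
Proof. by apply: (vd_inj V); exact: rz_mem rz i. Qed.

Let b_psi i : b \notin psi i.
Proof. by apply: notin_verts bX _; exact: rz_mem rz i. Qed.

Let p_psi i v : v \in psi i -> p v != b.
Proof.
move=> vi; apply: contraNneq bpX => <-; apply: mem_im.
by apply/in_verts; exists (psi i) => //; exact: rz_mem rz i.
Qed.

(** The subdivision of the generalized complex at the image of [A] is presented
    by the subdivision at [A], the new vertex being marked. The generators of
    the generalized complex glued to [g0] along the image of [A] have to be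
    those which contain [A] itself; this is automatic when [A] has a marked
    vertex. The second case of [star_cond] also asks that two generators around
    [A] have no common labels but those of their common vertices: a face
    through [b] is glued in the subdivision as soon as its sum with [A] is
    glued below, while the new mark requires it to come from a common face. *)
Lemma gsubdivision_realizes : exists L psi',
  gsubdivision K L /\ @realizes L (stellar_sub A b X) p (b |` Z) psi'.
Proof.
have [i0 i0E] := rz_surj rz g0X.
have star j : gglue i0 j (im p A) = (A `<=` psi j).
  rewrite (rz_glue rz) i0E /qglue fsubsetI (imS p Ag0) /=.
  have Ainj := vd_inj V g0X.
  apply/andP/idP => [[Aj Ag]|Aj]; last first.
    rewrite (imS p Aj); split=> //; apply/implyP => _; apply: imS.
    by rewrite fsubsetI Ag0.
  case: star_cond => [AZ|[h _]]; last by apply: h => //; exact: rz_mem rz j.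
  move: Ag; rewrite AZ /= => /(im_capP _ Ainj (imS p Ag0)) H.
  apply/fsubsetP => v vA; apply: H; last exact: mem_im.
  by move/fsubsetP: Ag0; apply.
pose L := gsubdiv i0 (im p A) b.
(* The removed vertex of [A] is known by its label only; [p] being injective
   on [psi j], it is removed by filtering. *)
pose psi' (x : gidx L) : simplex :=
  if (val x).2 is Some y then b |` [fset z in psi (val x).1 | p z != val y]
  else psi (val x).1.
have spec x : (exists j v, [/\ (val x).1 = j, A `<=` psi j, v \in A,
      omap val (val x).2 = Some (p v) & psi' x = b |` (psi j `\ v)]) \/
    [/\ ~~ (A `<=` psi (val x).1), (val x).2 = None & psi' x = psi (val x).1].
  rewrite /psi'; have := valP x; rewrite star; case: (val x) => j [y|] /= /eqP/esym Aj.
    left; have /imP[v vA yv] := valP y.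
    have vj : v \in psi j by move/fsubsetP: Aj; apply.
    exists j, v; split=> //; first by rewrite yv.
    congr (_ |` _); apply/fsetP => z; rewrite !inE /= yv.
    case: (boolP (z \in psi j)) => zj; rewrite ?andbF ?andbT //=.
    by rewrite (inj_in_eq (@pinj j)).
  by right; rewrite Aj.
have vertE x : gvert x = im p (psi' x).
  rewrite /= /gsubdiv_vert; case: (spec x) => [[j [v [-> Aj vA]]]|[_ -> ->]]; last exact: rz_vert rz _.
  case: (val x).2 => //= y [yv] ->; rewrite im_U1 pb im_D1 //.
    by rewrite (rz_vert rz) yv.
  by move/fsubsetP: Aj; apply.
have b_in x : (b \in psi' x) = isSome (val x).2.
  case: (spec x) => [[j [v [_ Aj vA + ->]]]|[_ -> ->]]; last exact/negbTE/b_psi.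
  by case: (val x).2 => //= y _; rewrite fset1U1.
exists L, psi'; split.
  exists i0, (im p A), b; split=> //.
  - have [v vA] := fset0Pn _ A0; apply/fset0Pn; exists (p v); exact: mem_im.
  - by rewrite (rz_vert rz) i0E imS.
  - by move=> j; rewrite (rz_vert rz); apply/imP => -[v vj /eqP]; rewrite eq_sym (negPf (p_psi vj)).
split=> //.
- move=> x y e; apply: val_inj.
  case: (spec x) => [[j [v [xj Aj vA xv E]]]|[Ax xN E]];
  case: (spec y) => [[k [w [yk Ak wA yw E']]]|[Ay yN E']].
  + have vj : v \in psi j by move/fsubsetP: Aj; apply.
    have wj : w \in psi j by move/fsubsetP: Aj; apply.
    have vk : v \in psi k by move/fsubsetP: Ak; apply.
    have e' : psi j `\ v = psi k `\ w.
      have bD i u : b \notin psi i `\ u by rewrite inE negb_and b_psi orbT.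
      by rewrite -(fsetU1K (bD j v)) -E e E' fsetU1K.
    have vw : v = w.
      apply/eqP; rewrite -[_ == _]negbK; apply/negP => nvw.
      by have := in_fsetD1 (psi j) v v; rewrite e' !inE nvw vk eqxx.
    have jk : j = k by apply: (rz_inj rz); rewrite -(fsetD1K vj) e' vw fsetD1K // -vw.
    move: xj xv yk yw; rewrite vw jk; case: (val x) (val y) => j1 [y1|] [j2 [y2|]] //=.
    by move=> -> [e1] -> [e2]; congr (_, Some _); apply: val_inj; rewrite /= e1.
  + by have := b_in x; rewrite e b_in yN; case: (val x).2 xv.
  + by have := b_in y; rewrite -e b_in xN; case: (val y).2 yw.
  + move: E E'; rewrite e => -> /(rz_inj rz); move: xN yN.
    by case: (val x) (val y) => j1 o1 [j2 o2] /= -> -> ->.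
- move=> x; apply/stellar_subP.
  case: (spec x) => [[j [v [xj Aj vA xv E]]]|[Ax xN E]].
    by left; exists (psi j), v; split=> //; exact: rz_mem rz _.
  by right; rewrite E; split=> //; exact: rz_mem rz _.
- move=> g /stellar_subP[[k [v [/(rz_surj rz)[j <-] Aj vA ->]]]|[/(rz_surj rz)[j <-] Aj]].
    have sP : isSome (Some [` mem_im p vA]) == gglue i0 j (im p A) by rewrite star Aj.
    exists (exist _ (j, Some [` mem_im p vA]) sP : gidx L).
    rewrite /psi' /=; congr (_ |` _); apply/fsetP => z; rewrite !inE /=.
    case: (boolP (z \in psi j)) => zj; rewrite ?andbF ?andbT //=.
    rewrite (inj_in_eq (@pinj j)) //.
    by move/fsubsetP: Aj; apply.
  have sP : isSome (None : option (im p A)) == gglue i0 j (im p A) by rewrite star (negPf Aj).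
  by exists (exist _ (j, None) sP : gidx L).
have vertE' x : @gsubdiv_vert K i0 (im p A) b x = im p (psi' x) := vertE x.
have sub x u : u \in psi' x -> u != b -> u \in psi (val x).1.
  case: (spec x) => [[j [v [<- _ _ _ ->]]]|[_ _ ->]] //.
  by rewrite !inE => /orP[-> //|/andP[_ ->]].
have back x w : w \in psi (val x).1 -> p w \in im p (psi' x) -> w \in psi' x.
  move=> wx /imP[u ux e]; have ub : u != b.
    by apply: contraNneq (p_psi wx) => ub; rewrite e ub pb.
  by rewrite (pinj wx (sub _ _ ux ub) e).
(* Apart from [b], a label shared by two new generators belongs to a common
   vertex of theirs as soon as it belongs to a common vertex of the old ones:
   by injectivity it is not the label of a removed vertex. *)
have core x y (F : simplex) : F `<=` im p (psi' x) `&` im p (psi' y) -> b \notin F ->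
    [/\ F `<=` im p (psi (val x).1), F `<=` im p (psi (val y).1) &
     (F `<=` im p (psi' x `&` psi' y)) = (F `<=` im p (psi (val x).1 `&` psi (val y).1))].
  rewrite fsubsetI => /andP[Fx Fy] bF.
  have lift z : F `<=` im p (psi' z) -> F `<=` im p (psi (val z).1).
    move=> /fsubsetP Fz; apply/fsubsetP => t tF; have /imP[u uz e] := Fz _ tF.
    rewrite e; apply: mem_im; apply: sub => //.
    by apply: contraNneq bF => ub; rewrite -pb -ub -e.
  split; try exact: lift.
  apply/fsubsetP/fsubsetP => H t tF; have /imP[u] := H _ tF; rewrite inE => /andP[ux uy] e.
    rewrite e mem_im // inE !sub //; apply: contraNneq bF => ub; by rewrite -pb -ub -e.
  rewrite e mem_im // inE !back // -e; first by move/fsubsetP: Fy; apply.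
  by move/fsubsetP: Fx; apply.
move=> x y F; rewrite /= /gsubdiv_glue /qglue !vertE'.
case: (boolP (F `<=` _)) => //= FV; rewrite (rz_glue rz) /qglue.
case: ifP => [bF|/negbT bF]; last first.
  have [Fx Fy ->] := core _ _ _ FV bF; rewrite fsubsetI Fx Fy /=.
  by rewrite fdisjointXU fdisjointX1 bF.
have bx z : F `<=` im p (psi' z) -> b \in psi' z /\ A `<=` psi (val z).1.
  move=> /fsubsetP/(_ _ bF)/imP[u uz e].
  have bz : b \in psi' z.
    have [<- //|ub] := eqVneq u b.
    by have := p_psi (sub _ _ uz ub); rewrite -e eqxx.
  split=> //; case: (spec z) => [[j [v [-> ]]]|[_ _ E]] //.
  by rewrite E (negPf (b_psi _)) in bz.
have [Fx Fy] : F `<=` im p (psi' x) /\ F `<=` im p (psi' y).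
  by apply/andP; rewrite -fsubsetI.
have /= [[bx' Ax] [by' Ay]] := (bx _ Fx, bx _ Fy).
have bF' : b \notin F `\ b by rewrite !inE eqxx.
have FV' : F `\ b `<=` im p (psi' x) `&` im p (psi' y).
  by apply: fsubset_trans FV; exact: fsubD1set.
have /= [Gx Gy E] := core _ _ _ FV' bF'.
have -> : [disjoint F & b |` Z]%fset = false.
  by apply/negbTE/negP => /fdisjointP/(_ _ bF); rewrite fset1U1.
rewrite fsubsetI !fsubUset Gx Gy !(imS p) ?fsubsetI ?Ax ?Ay //=.
have -> : (F `<=` im p (psi' x `&` psi' y)) = (F `\ b `<=` im p (psi' x `&` psi' y)).
  apply/fsubsetP/fsubsetP => H t.
    by rewrite inE => /andP[_]; exact: H.
  have [->|tb] := eqVneq t b; last by move=> tF; apply: H; rewrite !inE tb.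
  by move=> _; rewrite -{1}pb mem_im // inE bx' by'.
rewrite E fdisjointUX negb_and.
case: star_cond => [-> //|[_ H]].
suff /= -> : F `\ b `<=` im p (psi (val x).1 `&` psi (val y).1) by rewrite implybT.
apply: fsubset_trans (H _ _ _ _ Ax Ay); try exact: rz_mem rz _.
by rewrite fsubsetI Gx.
Qed.
End GSub.

Lemma sub_equiv n K X p Z psi A g0 b : valid n X p Z -> @realizes K X p Z psi ->
  A != fset0 -> g0 \in X -> A `<=` g0 ->
  b \notin verts X -> b \notin im p (verts X) -> p b = b ->
  (~~ [disjoint im p A & Z]%fset \/
   (forall h, h \in X -> im p A `<=` im p h -> A `<=` h) /\
   (forall g h, g \in X -> h \in X -> A `<=` g -> A `<=` h ->
     im p g `&` im p h `<=` im p (g `&` h))) ->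
  exists L psi', [/\ gstellar_equiv K L, gstellar_equiv L K &
    @realizes L (stellar_sub A b X) p (b |` Z) psi'].
Proof.
move=> V rz A0 g0X Ag0 bX bpX pb cond.
have [L [psi' [KL rL]]] := gsubdivision_realizes V rz A0 g0X Ag0 bX bpX pb cond.
have aK := realizes_axioms V rz.
have aL := realizes_axioms (valid_sub A V bX bpX pb) rL.
exists L, psi'; split=> //; apply: rt_step; split=> //.
  by constructor 1.
by constructor 2.
Qed.

(** * Counting generators over a facet *)

Section Count.
Variable T : choiceType.
Implicit Types (S : {fset T}) (P : pred T).

Lemma sum_card S P : (\sum_(g <- S) P g)%N = #|` [fset g in S | P g]|.
Proof.
rewrite card_fset_sum1 -(big_fset_condE _ S P) [RHS]big_mkcond /=.
by apply: eq_bigr => g _; case: (P g).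
Qed.

Lemma sum_fsetU (A B : {fset T}) (F : T -> nat) : [disjoint A & B]%fset ->
  (\sum_(g <- A `|` B) F g = \sum_(g <- A) F g + \sum_(g <- B) F g)%N.
Proof.
move=> dAB; rewrite (big_fsetID _ (mem A)) /=; congr (_ + _)%N; apply: eq_fbig => // g.
  by rewrite !inE /= andb_orl andbb; case: (g \in A); rewrite ?andbF.
rewrite !inE /= andb_orl andbN /=; case: (boolP (g \in B)) => //= gB.
by rewrite fdisjoint_sym in dAB; move/fdisjointP: dAB; apply.
Qed.
End Count.

Lemma card_le2 (T : choiceType) (A : {fset T}) :
  (forall x y z, x \in A -> y \in A -> z \in A -> [\/ x = y, x = z | y = z]) ->
  (#|` A| <= 2)%N.
Proof.
move=> H; case: (fset_0Vmem A) => [->|[x xA]]; first by rewrite cardfs0.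
rewrite (cardfsD1 x) xA; case: (fset_0Vmem (A `\ x)) => [->|[y]]; first by rewrite cardfs0.
rewrite !inE => /andP[yx yA]; rewrite (cardfsD1 y) !inE yx yA.
case: (fset_0Vmem (A `\ x `\ y)) => [->|[z]]; first by rewrite cardfs0.
rewrite !inE => /and3P[zy zx zA]; have [e|e|e] := H _ _ _ xA yA zA.
- by rewrite e eqxx in yx.
- by rewrite e eqxx in zx.
- by rewrite e eqxx in zy.
Qed.

(** The facets of the image of a simplex embedded by [p] are the images of its
    facets, each obtained once. *)
Lemma sum_bd p (t F : simplex) : {in t &, injective p} ->
  (\sum_(g <- simplex_bd t) (im p g == F))%N = (F \in simplex_bd (im p t)) :> nat.
Proof.
move=> pinj; have sub v : v \in t -> im p (t `\ v) = im p t `\ p v by exact: im_D1.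
case: (boolP (F \in _)) => [/simplex_bdP[_ /imP[v vt ->] ->]|nF]; last first.
  rewrite big_seq big1 // => g /simplex_bdP[v vt ->]; case: eqP => // e.
  case/negP: nF; apply/simplex_bdP; exists (p v); first exact: mem_im.
  by rewrite -e sub.
have vbd : t `\ v \in simplex_bd t by apply/simplex_bdP; exists v.
rewrite (big_fsetD1 _ vbd) /= sub // eqxx big_seq big1 ?addn0 // => g.
rewrite !inE => /andP[gv /simplex_bdP[w wt ge]]; rewrite ge sub //.
case: eqP => // /fsetP/(_ (p v)); rewrite !inE eqxx mem_im //= andbT => /negbFE/eqP/pinj e.
by rewrite ge -e ?eqxx in gv.
Qed.

(** * Cones, and replacing a generator of the base *)

Lemma fresh_int (V : {fset int}) : exists b, b \notin V.
Proof.
exists (\sum_(v <- V) `|v| + 1)%R; apply/negP => bV.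
have : ((\sum_(v <- V) `|v| + 1) <= \sum_(v <- V) `|v|)%R.
  rewrite {2}(big_fsetD1 _ bV) /= ger0_norm; last first.
    by apply: addr_ge0 => //; apply: sumr_ge0.
  by rewrite lerDl; apply: sumr_ge0.
by rewrite gerDl.
Qed.

Definition cone (a : int) (S : complex) : complex := [fset a |` g | g in S].

Lemma coneP a S h : reflect (exists2 g, g \in S & h = a |` g) (h \in cone a S).
Proof. by apply: (iffP (imfsetP _ _ _ _)) => -[g gS ->]; exists g. Qed.

Section Valid.
Variables (n : nat) (M : complex) (a : int) (p : int -> int) (S T : complex).
Hypotheses (aM : a \notin verts M) (pa : p a = a) (aS : a \notin verts S).
Hypothesis Scard : forall g, g \in S -> #|` g| = n.
Hypothesis Sinj : forall g, g \in S -> {in g &, injective p}.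
Hypothesis SM : forall g, g \in S -> im p g `<=` verts M.
Hypothesis Tcard : forall g, g \in T -> #|` g| = n.+1.
Hypothesis Tinj : forall g, g \in T -> {in g &, injective p}.
Hypothesis TM : forall g, g \in T -> im p g `<=` verts M.
Hypothesis Tfree : {in T &, injective (im p)}.

(** In a cone with unabsorbed generators [T], every generator through the apex
    is marked, so that only the generators of [T] have to be told apart by
    their labels. *)
Lemma valid_cone : valid n (cone a S `|` T) p [fset a].
Proof.
have inM g (v : int) : im p g `<=` verts M -> v \in g -> p v != a.
  move=> /fsubsetP gM vg; apply: contraNneq aM => <-; apply: gM; exact: mem_im.
split.
- move=> g; rewrite inE => /orP[/coneP[h hS ->]|/Tcard //].
  by rewrite cardfsU1 (notin_verts aS hS) Scard.
- move=> g; rewrite inE => /orP[/coneP[h hS ->]|/Tinj //] x y; rewrite !inE.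
  have nh z : z \in h -> p z != a by apply: inM; exact: SM.
  case/orP=> [/eqP ->|xh]; case/orP=> [/eqP ->|yh] //; rewrite ?pa.
  + by move=> e; case/eqP: (nh _ yh).
  + by move=> e; case/eqP: (nh _ xh).
  + exact: Sinj hS _ _ xh yh.
- move=> x /in_verts[g]; rewrite !inE => + xg /eqP px; case/orP.
    move=> /coneP[h hS ge]; move: xg; rewrite ge !inE => /orP[/eqP -> //|xh].
    by case/eqP: (inM _ _ (SM hS) xh).
  by move=> gT; case/eqP: (inM _ _ (TM gT) xg).
have onlyT g : g \in cone a S `|` T -> [disjoint im p g & [fset a]]%fset -> g \in T.
  rewrite inE fdisjointX1 => /orP[/coneP[h hS ->]|//].
  by rewrite im_U1 pa fset1U1.
move=> g h gX hX e ga; have ha : [disjoint im p h & [fset a]]%fset by rewrite -e.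
by apply: Tfree => //; exact: onlyT.
Qed.
End Valid.

Lemma joinfs0 K : join K [fset fset0] = K.
Proof.
apply/fsetP => h; apply/joinP/idP => [[q [r [qK]]]|hK].
  by rewrite inE => /eqP -> ->; rewrite fsetU0.
by exists h, fset0; rewrite inE fsetU0.
Qed.

Lemma in_rest A K h : (h \in rest A K) = (h \in K) && ~~ (A `<=` h).
Proof. by rewrite !inE. Qed.

(** This is the subdivision of [S] at the generator [f] with new vertex [w]; it
    is written with the boundary of [w |` f], from which [f] is removed, so
    that generators can be counted by inclusion and exclusion. *)
Definition replace (f : simplex) (w : int) (S : complex) : complex :=
  (S `\ f) `|` (simplex_bd (w |` f) `\ f).

Section Replace.
Variables (n : nat) (S : complex) (f : simplex) (w : int).
Hypotheses (fS : f \in S) (wS : w \notin verts S).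

Let wf : w \notin f. Proof. exact: notin_verts wS fS. Qed.

Lemma replaceP h : reflect ((h != f /\ h \in S) \/ (exists2 x, x \in f & h = w |` (f `\ x)))
  (h \in replace f w S).
Proof.
have E x : x \in f -> (w |` f) `\ x = w |` (f `\ x).
  move=> xf; apply/fsetP => z; rewrite !inE; case: (z =P w) => //= ->.
  by rewrite andbT; apply: contraNneq wf => ->.
rewrite !inE; apply: (iffP orP).
  case=> [/andP[]|/andP[hf /simplex_bdP[x]]]; first by left.
  rewrite !inE => /orP[/eqP ->|xf he]; first by rewrite fsetU1K // => e; rewrite e eqxx in hf.
  by right; exists x => //; rewrite he E.
case=> [[-> ->]|[x xf he]]; first by left.
right; rewrite he -E //; apply/andP; split; last first.
  by apply/simplex_bdP; exists x => //; rewrite inE xf orbT.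
by rewrite E //; apply: contraNneq wf => <-; exact: fset1U1.
Qed.

Hypothesis Scard : forall g, g \in S -> #|` g| = n.

Lemma replace_card g : g \in replace f w S -> #|` g| = n.
Proof.
move=> /replaceP[[_ /Scard //]|[x xf ->]].
rewrite cardfsU1 inE negb_and wf orbT.
by rewrite -(Scard fS) (cardfsD1 x f) xf.
Qed.

Lemma weld_replace : f != fset0 -> weld (replace f w S) S.
Proof.
move=> f0; have [x0 x0f] := fset0Pn _ f0.
exists f, w, [fset fset0]; split; split=> //.
- apply/in_verts; exists (w |` (f `\ x0)); last exact: fset1U1.
  by apply/replaceP; right; exists x0.
- move=> [g gS' fg]; have e : g = f.
    by apply/esym/eqP; rewrite eqEfcard fg (replace_card gS') Scard ?leqnn.
  case/replaceP: gS' => [[/eqP //]|[x xf ge]].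
  by case/negP: wf; rewrite -e ge fset1U1.
- move=> g; rewrite inE => /eqP ->; exists (w |` (f `\ x0)); last exact: fsub0set.
  by apply/replaceP; right; exists x0.
- apply/fdisjointP => v _; apply/negP => /in_verts[g]; rewrite inE => /eqP ->.
  by rewrite inE.
- rewrite joinfs0; apply/fsetP => h; apply/linkP/simplex_bdP.
    move=> [g [/replaceP[[_ gS]|[x xf ->]]]].
      by rewrite fsub1set (negPf (notin_verts wS gS)).
    by move=> _ ->; exists x => //; rewrite fsetU1K // inE negb_and wf orbT.
  move=> [x xf ->]; exists (w |` (f `\ x)); split.
  + by apply/replaceP; right; exists x.
  + by rewrite fsub1set fset1U1.
  + by rewrite fsetU1K // inE negb_and wf orbT.
rewrite joinfs0; apply/fsetP => h; rewrite in_fsetU in_fset1 in_rest fsub1set.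
have [->|hf] := eqVneq h f; first by rewrite fS.
apply/idP/andP => [hS|[/replaceP[[]//|[x xf ->]]]].
  by rewrite (notin_verts wS hS); split=> //; apply/replaceP; left.
by rewrite fset1U1.
Qed.

Lemma sum_replace (P : simplex -> nat) :
  (\sum_(g <- replace f w S) P g + (P f).*2 =
   \sum_(g <- S) P g + \sum_(g <- simplex_bd (w |` f)) P g)%N.
Proof.
have fbd : f \in simplex_bd (w |` f).
  by apply/simplex_bdP; exists w; rewrite ?fset1U1 // fsetU1K.
rewrite (big_fsetD1 _ fS) (big_fsetD1 _ fbd) /=.
rewrite /replace; set B := _ `\ f; set C := _ `\ f.
have -> : (\sum_(g <- B `|` C) P g = \sum_(g <- B) P g + \sum_(g <- C) P g)%N.
  apply: sum_fsetU; apply/fdisjointP => g; rewrite !inE => /andP[gf gS].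
  rewrite gf /=; apply/negP => /simplex_bdP[x]; rewrite !inE => /orP[/eqP ->|xf] ge.
    by rewrite fsetU1K // in ge; rewrite ge eqxx in gf.
  have := notin_verts wS gS; rewrite ge !inE eqxx andbT negbK => /eqP wx.
  by move: wf; rewrite wx xf.
by move: (\sum_(g <- B) P g)%N (\sum_(g <- C) P g)%N (P f) => u v k; lia.
Qed.
End Replace.

Section Unfolding.
Variables (R : realType) (n : nat) (M : complex) (a : int).
Hypotheses (mM : stellar_manifold n M) (conn : connected (realization R M)).
Hypothesis aM : a \notin verts M.

Let thinM : thin M. Proof. exact: thin_manifold mM conn. Qed.
Let unifM : uniform n M. Proof. exact: (proj1 mM). Qed.

(** * Unfolding the manifold *)

(** The generators of [M] outside [T] have been absorbed in the cone from [a]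
    over the sphere [S], whose vertices are sent by [p] to the vertices of [M]
    that they lie over. In [uf_count], [k F] counts the gluings made along
    [F]: each hides two facets of absorbed generators from [S]. *)
Record unfolding (S T : complex) (p : int -> int) : Prop := Unfolding {
  uf_sub : T `<=` M;
  uf_ne : M `\` T != fset0;
  uf_sphere : stellar_sphere n S;
  uf_apex : a \notin verts S;
  uf_id : {in verts M, forall v, p v = v};
  uf_pa : p a = a;
  uf_card : forall g, g \in S -> #|` g| = n;
  uf_inj : forall g, g \in S -> {in g &, injective p};
  uf_im : forall g, g \in S -> im p g `<=` verts M;
  uf_count : exists k : simplex -> nat, forall F,
    (\sum_(t <- M `\` T) (F \in simplex_bd t) =
     \sum_(g <- S) (im p g == F) + (k F).*2)%N;
  uf_equiv : exists K psi, gstellar_equiv (gcomplex_of M) K /\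
    @realizes K (cone a S `|` T) p [fset a] psi }.

Lemma im_id (g : simplex) : im id g = g.
Proof. by apply/fsetP => y; apply/imP/idP => [[v vg ->]|yg] //; exists y. Qed.

Lemma im_idM p (g : simplex) : {in verts M, forall v, p v = v} -> g \in M -> im p g = g.
Proof.
move=> pid gM; rewrite -[RHS]im_id; apply: eq_in_im => v vg; apply: pid.
by apply/in_verts; exists g.
Qed.

Lemma gen_sub g : g \in M -> g `<=` verts M.
Proof. by move=> gM; apply/fsubsetP => v vg; apply/in_verts; exists g. Qed.

Lemma sub_gen (g h : simplex) : #|` g| = #|` h| -> g `<=` h -> g = h.
Proof. by move=> e gh; apply/eqP; rewrite eqEfcard gh e leqnn. Qed.

Lemma sphere_bd t : #|` t| = n.+1 -> stellar_sphere n (simplex_bd t).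
Proof.
move=> ct; apply: rt_step; constructor 3.
pose f v : int := Posz (index v t).+1.
have finj : {in t &, injective f}.
  by move=> x y xt yt [] e; rewrite -(nth_index 0%R xt) e nth_index.
have fim : im f t = std_simplex n.+1.
  apply/fsetP => y; apply/imP/imfsetP => [[v vt ->]|[i + ->]].
    by exists (index v t).+1 => //; rewrite [_ \in _]mem_iota /= add1n ltnS -ct index_mem.
  rewrite [_ \in _]mem_iota add1n ltnS => /andP[i0 ilt].
  have it : (i.-1 < size t)%N by rewrite ct; lia.
  exists (nth 0%R t i.-1); first exact: mem_nth.
  by rewrite /f index_uniq ?fset_uniq // prednK.
exists f; split.
  have sub v : v \in verts (simplex_bd t) -> v \in t.
    by move=> /in_verts[g /simplex_bdP[w wt ->]]; rewrite inE => /andP[].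
  by move=> x y /sub xt /sub yt; exact: finj.
rewrite -fim; apply/fsetP => h; apply/simplex_bdP/relabelP.
  move=> [_ /imP[v vt ->] ->]; exists (t `\ v); last by rewrite im_D1.
  by apply/simplex_bdP; exists v.
move=> [_ /simplex_bdP[v vt ->] ->]; exists (f v); first exact: mem_im.
by rewrite im_D1.
Qed.

Lemma unfolding_start t0 : t0 \in M -> unfolding (simplex_bd t0) (M `\ t0) id.
Proof.
move=> t0M.
have t0v := gen_sub t0M.
have star0 g : g \in M -> t0 `<=` g -> g = t0.
  by move=> gM tg; apply/esym/sub_gen; rewrite // !unifM.
have V0 : valid n M id fset0.
  split=> //; first by move=> g _ x y.
  by move=> g h _ _; rewrite !im_id.
have r0 : @realizes (gcomplex_of M) M id fset0 (fun g => val g).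
  split=> //.
  - by move=> i; exact: valP.
  - by move=> g gM; exists [` gM].
  - by move=> i; rewrite im_id.
  - by move=> i j F /=; rewrite /qglue !im_id fdisjointX0 /= andbT.
have t00 : t0 != fset0 by rewrite -cardfs_gt0 (unifM t0M).
have [|||K [psi [MK _ rK]]] := sub_equiv (b := a) V0 r0 t00 t0M (fsubset_refl _) aM.
- by rewrite im_id.
- by [].
- by right; rewrite im_id; split=> [h _|g h _ _ _ _]; rewrite !im_id // fsubset_refl.
have E : stellar_sub t0 a M = cone a (simplex_bd t0) `|` (M `\ t0).
  apply/fsetP => h; rewrite in_fsetU in_fsetD1; apply/stellar_subP/orP.
    case=> [[g [v [gM tg vt ->]]]|[hM th]].
      left; apply/coneP; exists (t0 `\ v); first by apply/simplex_bdP; exists v.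
      by rewrite (star0 _ gM tg).
    by right; rewrite hM andbT; apply: contraNneq th => ->.
  case=> [/coneP[_ /simplex_bdP[v vt ->] ->]|/andP[ht hM]].
    by left; exists t0, v; rewrite fsubset_refl.
  right; split=> //; apply/negP => /(star0 _ hM) e.
  by rewrite e eqxx in ht.
have MD : M `\` (M `\ t0) = [fset t0].
  apply/fsetP => g; rewrite !inE negb_and negbK.
  have [->|_] /= := eqVneq g t0; first by rewrite t0M.
  by case: (g \in M).
have bdv g : g \in simplex_bd t0 -> g `<=` t0.
  by move=> /simplex_bdP[v _ ->]; exact: fsubD1set.
split=> //.
- exact: fsubD1set.
- by rewrite MD; apply/fset0Pn; exists t0; rewrite inE.
- by apply: sphere_bd; exact: unifM.
- apply/negP => /in_verts[g /bdv/fsubsetP gt /gt at0].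
  by have := notin_verts aM t0M; rewrite at0.
- move=> g /simplex_bdP[v vt ->]; apply/eqP; rewrite -eqSS -(unifM t0M).
  by rewrite (cardfsD1 v t0) vt.
- by move=> g _ x y.
- by move=> g /bdv gt; rewrite im_id; exact: fsubset_trans gt t0v.
- exists (fun=> 0%N) => F; rewrite MD big_seq_fset1 sum_bd; last by move=> x y.
  by rewrite im_id addn0.
by exists K, psi; rewrite -E -[[fset a]]fsetU0.
Qed.

Lemma facet_coface (F t : simplex) : t \in M -> F \in simplex_bd t ->
  exists2 x, coface M F x & t = x |` F.
Proof.
move=> tM /simplex_bdP[x xt ->]; exists x; last by rewrite fsetD1K.
by split; rewrite ?fsetD1K // !inE eqxx.
Qed.

Lemma sum_eq1 (S : complex) (P : pred simplex) : (\sum_(g <- S) P g)%N = 1%N ->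
  exists f, [/\ f \in S, P f & forall g, g \in S -> P g -> g = f].
Proof.
rewrite sum_card => /eqP/cardfs1P[f fE].
have key g : (g \in S) && P g = (g == f).
  by move/fsetP: fE => /(_ g); rewrite !inE.
exists f; have := key f; rewrite eqxx => /andP[-> ->]; split=> // g gS Pg.
by apply/eqP; rewrite -key gS.
Qed.

Lemma count_arith (s s' d x k : nat) :
  (s' + x.*2 = s + d -> d + (s + k.*2) = s' + (k + x).*2)%N.
Proof. lia. Qed.

Section Step.
Variables (S T : complex) (p : int -> int).
Hypotheses (U : unfolding S T p) (T0 : T != fset0).

(** A generator [y |` F] not yet absorbed, next to an absorbed one along [F].
    As [M] is thin, exactly one absorbed generator contains [F], so that by
    [uf_count] exactly one generator [f] of [S] lies over [F]. *)
Lemma find_gluing : exists f F y,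
  [/\ [/\ F != fset0, f \in S & im p f = F],
      [/\ y \notin F, y |` F \in T & y \in verts M],
      forall g, g \in S -> im p g = F -> g = f &
      forall t, t \in T -> F `<=` t -> t = y |` F].
Proof.
have [h0 h0T] := fset0Pn _ T0; have [g0] := fset0Pn _ (uf_ne U).
rewrite inE => /andP[g0T g0M]; have /fsubsetP TM := uf_sub U.
have [|F [x [y [F0 cx cy xT yT]]]] := @manifold_adjacent R n M (fun g => g \notin T) g0 h0 mM conn g0M (TM _ h0T) g0T.
  by rewrite h0T.
rewrite negbK in yT.
have xy : x != y by apply: contraNneq xT => ->.
have onlyT t : t \in T -> F `<=` t -> t = y |` F.
  move=> tT Ft; have [z zt zF] : exists2 z, z \in t & z \notin F.
    apply/fsubsetPn; apply/negP => tF.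
    have := fsubset_leq_card tF; rewrite (unifM (TM _ tT)).
    by have := unifM (proj2 cx); rewrite cardfsU1 (proj1 cx) add1n => -[->]; rewrite ltnn.
  have te : z |` F = t.
    apply: sub_gen; last by rewrite fsubUset fsub1set zt.
    rewrite cardfsU1 zF (unifM (TM _ tT)).
    by have := unifM (proj2 cx); rewrite cardfsU1 (proj1 cx).
  have cz : coface M F z by split; rewrite // te TM.
  have [e|e|e] := thinM cx cy cz; first by rewrite e eqxx in xy.
    by move: xT; rewrite e te tT.
  by rewrite -te e.
have [k kE] := uf_count U.
have c1 : (\sum_(t <- M `\` T) (F \in simplex_bd t))%N = 1%N.
  have xMT : x |` F \in M `\` T by rewrite inE xT (proj2 cx).
  rewrite (big_fsetD1 _ xMT) /=.
  have -> : F \in simplex_bd (x |` F).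
    by apply/simplex_bdP; exists x; rewrite ?fset1U1 // fsetU1K ?(proj1 cx).
  rewrite big_seq big1 // => t; rewrite !inE => /and3P[tx tT tM].
  apply/eqP; rewrite eqb0; apply/negP => /(facet_coface tM) [z cz te].
  have [e|e|e] := thinM cx cy cz; first by rewrite e eqxx in xy.
    by rewrite te e eqxx in tx.
  by rewrite te -e yT in tT.
have s1 : (\sum_(g <- S) (im p g == F))%N = 1%N.
  by have := kE F; rewrite c1; move: (\sum_(g <- S) _)%N (k F) => u v; lia.
have [f [fS /eqP fF fu]] := sum_eq1 s1.
exists f, F, y; split=> //.
  by split=> //; [exact: (proj1 cy) | exact: coface_verts cy].
by move=> g gS /eqP gF; exact: fu.
Qed.

(** With [t] relifted to [w |` f], the complex [X1] has the generators [a |` f]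
    and [w |` f] around [f]; [X2] has instead the generators through the edge
    [a w] over the facets of [f]. Their subdivisions at [f] and at the edge by
    the same vertex [b] are the same complex, and the corresponding moves of
    generalized complexes go from [X1] to [X2] through it. *)
Lemma unfolding_step : exists S' T' p', unfolding S' T' p' /\ (#|` T'| < #|` T|)%N.
Proof.
have [f [F [y [[F0 fS pf] [yF tT yM] uniq_f uniq_t]]]] := find_gluing.
have /fsubsetP TM := uf_sub U.
set t := y |` F in tT uniq_t *.
have tM := TM _ tT.
have f0 : f != fset0.
  have [z] := fset0Pn _ F0; rewrite -pf => /imP[v vf _].
  by apply/fset0Pn; exists v.
have [x0 x0f] := fset0Pn _ f0.
have [w wV] := fresh_int (a |` (verts M `|` verts S)).
have [b bV] := fresh_int (w |` (a |` (verts M `|` verts S))).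
move: wV bV; rewrite !in_fsetU !in_fset1 !negb_or => /and3P[wa wM wS] /and4P[bw ba bM bS].
pose p' u := if u == w then y else if u == b then b else p u.
have p'w : p' w = y by rewrite /p' eqxx.
have p'b : p' b = b by rewrite /p' (negPf bw) eqxx.
have p'E u : u != w -> u != b -> p' u = p u.
  by rewrite /p' => /negPf -> /negPf ->.
have p'M v : v \in verts M -> p' v = v.
  move=> vM; rewrite p'E ?(uf_id U) //.
    by apply: contraNneq wM => <-.
  by apply: contraNneq bM => <-.
have p'a : p' a = a by rewrite p'E ?(uf_pa U) // eq_sym.
have p'S g : g \in S -> {in g, p' =1 p}.
  move=> gS v vg; apply: p'E.
    by apply: contraNneq (notin_verts wS gS) => <-.
  by apply: contraNneq (notin_verts bS gS) => <-.
have p'SE g : g \in S -> im p' g = im p g by move=> /p'S; exact: eq_in_im.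
have p'Sinj g : g \in S -> {in g &, injective p'}.
  by move=> gS u v ug vg; rewrite !(p'S _ gS) //; exact: uf_inj U _ gS _ _ ug vg.
have wf := notin_verts wS fS; have bf := notin_verts bS fS.
have af := notin_verts (uf_apex U) fS.
have p'wf : im p' (w |` f) = t by rewrite im_U1 p'w p'SE // pf.
have p'wfinj : {in w |` f &, injective p'}.
  have ny v : v \in f -> p' v != y.
    move=> vf; apply: contraNneq yF => <-.
    by rewrite -pf -(p'SE _ fS); exact: mem_im.
  move=> u v; rewrite !inE => /orP[/eqP->|uf] /orP[/eqP->|vf] //; rewrite ?p'w.
  - by move=> e; case/eqP: (ny _ vf).
  - by move=> e; case/eqP: (ny _ uf).
  - exact: p'Sinj fS _ _ uf vf.
pose S' := replace f w S; pose T' := T `\ t.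
pose X1 := cone a S `|` ((w |` f) |` T').
pose X2 := cone a S' `|` T'.
have T'P g : g \in T' -> [/\ g \in M, g != t & ~~ (F `<=` g)].
  rewrite in_fsetD1 => /andP[gt gT]; split=> //; first exact: TM.
  by apply/negP => /(uniq_t _ gT) e; rewrite e eqxx in gt.
have p'T g : g \in M -> im p' g = g by move=> gM; exact: im_idM.
have p'Tinj g : g \in M -> {in g &, injective p'}.
  by move=> gM u v ug vg; rewrite !p'M //; apply/in_verts; exists g.
have S'card : forall g, g \in S' -> #|` g| = n by apply: replace_card fS wS (uf_card U).
have S'sub g : g \in S' -> g \in S \/ g `<=` w |` f.
  move=> /(replaceP fS wS)[[_ gS]|[x xf ->]]; [by left | right].
  by apply: fsetUS; exact: fsubD1set.
have S'inj g : g \in S' -> {in g &, injective p'}.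
  move=> /S'sub[gS|/fsubsetP gw]; first exact: p'Sinj.
  by move=> u v /gw uw /gw vw; exact: p'wfinj.
have tv : t `<=` verts M := gen_sub tM.
have S'im g : g \in S' -> im p' g `<=` verts M.
  move=> /S'sub[gS|gw]; first by rewrite p'SE //; exact: uf_im U _ gS.
  by apply: fsubset_trans (imS p' gw) _; rewrite p'wf.
have aS' : a \notin verts S'.
  apply/negP => /in_verts[g /S'sub[gS|/fsubsetP gw] ag].
    by have := notin_verts (uf_apex U) gS; rewrite ag.
  by have := gw _ ag; rewrite !inE eq_sym (negPf wa) (negPf af).
have V1 : valid n X1 p' [fset a].
  apply: (valid_cone aM) => //; first exact: uf_apex U.
  - exact: uf_card U.
  - by move=> g gS; rewrite p'SE //; exact: uf_im U _ gS.
  - move=> g; rewrite !inE => /orP[/eqP ->|/andP[_ /TM /unifM //]].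
    by rewrite cardfsU1 wf (uf_card U fS).
  - by move=> g; rewrite in_fset1U => /orP[/eqP ->|/T'P[gM _ _]] //; exact: p'Tinj.
  - move=> g; rewrite in_fset1U => /orP[/eqP ->|/T'P[gM _ _]]; first by rewrite p'wf.
    by rewrite p'T //; exact: gen_sub.
  move=> g h; rewrite !in_fset1U => /orP[/eqP ->|/T'P[gM gt _]] /orP[/eqP ->|/T'P[hM ht _]] //.
  - by rewrite p'wf p'T // => e; rewrite -e eqxx in ht.
  - by rewrite p'wf p'T // => e; rewrite e eqxx in gt.
  - by rewrite !p'T.
have V2 : valid n X2 p' [fset a].
  apply: (valid_cone aM) => //.
  - by move=> g; rewrite inE => /andP[_ /TM /unifM].
  - by move=> g /T'P[gM _ _]; exact: p'Tinj.
  - by move=> g /T'P[gM _ _]; rewrite p'T //; exact: gen_sub.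
  - by move=> g h /T'P[gM _ _] /T'P[hM _ _]; rewrite !p'T.
have [K [psi [MK rK]]] := uf_equiv U.
(* Not containing the apex, [t] is unmarked and may be lifted as [w |` f]. *)
have [psi1 r1] : exists psi1, @realizes K X1 p' [fset a] psi1.
  pose phi g := if g == t then w |` f else g.
  have wfX : w |` f \notin cone a S `|` T.
    rewrite in_fsetU negb_or; apply/andP; split; apply/negP.
      move=> /coneP[g gS e]; have := fset1U1 w f; rewrite e !inE (negPf wa) /=.
      by rewrite (negPf (notin_verts wS gS)).
    by move=> /TM gM; have := notin_verts wM gM; rewrite fset1U1.
  have tX : t \notin cone a S.
    apply/negP => /coneP[g gS e]; have := notin_verts aM tM.
    by rewrite e fset1U1.
  have at' : [disjoint im p t & [fset a]]%fset.
    by rewrite fdisjointX1 (im_idM (uf_id U)) // (notin_verts aM tM).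
  have phiN g : g != t -> phi g = g by rewrite /phi => /negPf ->.
  have phit : phi t = w |` f by rewrite /phi eqxx.
  have p'X g : g \in cone a S `|` T -> g != t -> {in g, p' =1 p}.
    rewrite inE => /orP[/coneP[h hS ->]|gT] gt v.
      rewrite inE => /orP[|]; last exact: p'S.
      by rewrite inE => /eqP ->; rewrite p'a (uf_pa U).
    move=> vg; have vM : v \in verts M by apply/in_verts; exists g; rewrite ?TM.
    by rewrite p'M // (uf_id U).
  exists (phi \o psi); apply: (realizes_relift rK).
  - move=> g h gX hX; rewrite /phi.
    case: (eqVneq g t) => [->|gt]; case: (eqVneq h t) => [->|ht] // e.
      by rewrite e hX in wfX.
    by rewrite -e gX in wfX.
  - move=> g gX; have [->|gt] := eqVneq g t.
      by rewrite phit !inE eqxx orbT.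
    by rewrite phiN //; move: gX; rewrite !in_fsetU in_fset1 in_fsetD1 gt => /orP[]->; rewrite ?orbT.
  - move=> g; rewrite !in_fsetU in_fset1 in_fsetD1 => /or3P[gS|/eqP ->|/andP[gt gT]].
    + by exists g; rewrite ?phiN ?in_fsetU ?gS //; apply: contraNneq tX => <-.
    + by exists t; rewrite // in_fsetU tT orbT.
    + by exists g; rewrite ?phiN // in_fsetU gT orbT.
  - move=> g gX; have [->|gt] := eqVneq g t.
      by rewrite phit p'wf (im_idM (uf_id U)).
    by rewrite phiN //; apply: eq_in_im; exact: p'X.
  move=> g h gX hX ga ha.
  have gt : g != t by apply: contraNneq ga => ->.
  have ht : h != t by apply: contraNneq ha => ->.
  rewrite !phiN //; apply: eq_in_im => v; rewrite inE => /andP[vg _].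
  exact: (p'X g).
have bX1 : b \notin verts X1.
  apply/negP => /in_verts[g]; rewrite !in_fsetU in_fset1 => /or3P[/coneP[h hS ->]|/eqP ->|/T'P[gM _ _]].
  - by rewrite !inE (negPf ba) (negPf (notin_verts bS hS)).
  - by rewrite !inE (negPf bw) (negPf bf).
  - by rewrite (negPf (notin_verts bM gM)).
have imb (X : complex) : (forall g, g \in X -> b \notin im p' g) -> b \notin im p' (verts X).
  by move=> H; apply/imP => -[v /in_verts[g gX vg] e]; have := H _ gX; rewrite e mem_im.
have bim g : im p' g `<=` verts M -> b \notin im p' (a |` g).
  move=> /fsubsetP gM; rewrite im_U1 p'a !inE negb_or ba /=.
  by apply: contra bM; exact: gM.
have bpX1 : b \notin im p' (verts X1).
  apply: imb => g; rewrite !in_fsetU in_fset1 => /or3P[/coneP[h hS ->]|/eqP ->|/T'P[gM _ _]].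
  - by apply: bim; rewrite p'SE //; exact: uf_im U _ hS.
  - by rewrite p'wf (notin_verts bM tM).
  - by rewrite p'T // (notin_verts bM gM).
(* Only two generators have all the labels of [f]: no other generator of [S]
   lies over [F], and [t] is the only one of [T] through [F]. *)
have star1 h : h \in X1 -> im p' f `<=` im p' h -> h = a |` f \/ h = w |` f.
  rewrite !in_fsetU in_fset1 p'SE // pf => /or3P[/coneP[g gS ->]|/eqP ->|/T'P[gM _ Fg]]; last 2 first.
  - by right.
  - by rewrite p'T // (negPf Fg).
  rewrite im_U1 p'a => Fg; left; congr (_ |` _); apply: uniq_f => //; apply/esym.
  apply: sub_gen.
    by rewrite -pf !card_im ?(uf_card U) //; [exact: uf_inj U _ gS|exact: uf_inj U _ fS].
  apply/fsubsetP => z zF; move/fsubsetP: Fg => /(_ _ zF); rewrite !inE p'SE //.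
  case/orP=> // /eqP za; have := notin_verts aM tM.
  by rewrite -za !inE zF orbT.
have wfX1 : w |` f \in X1 by rewrite !in_fsetU in_fset1 eqxx orbT.
have afX1 : a |` f \in X1 by rewrite in_fsetU; apply/orP; left; apply/coneP; exists f.
have awf : (a |` f) `&` (w |` f) = f.
  apply/fsetP => z; rewrite !inE; case: (z =P a) => [->|_] /=.
    by rewrite eq_sym (negPf wa).
  by case: (z =P w) => [->|_] /=; rewrite ?andbT ?andbb // (negPf wf).
have awt : im p' (a |` f) `&` im p' (w |` f) `<=` im p' f.
  apply/fsubsetP => z; rewrite p'wf im_U1 p'a !inE => /andP[/orP[/eqP ->|//] ].
  move=> H; have := notin_verts aM tM; by rewrite !inE H.
have [|L1 [psiL1 [KL1 _ rL1]]] := sub_equiv V1 r1 f0 wfX1 (fsubsetUr _ _) bX1 bpX1 p'b.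
  right; split=> [h hX /(star1 _ hX)[]->|g h gX hX fg fh]; try exact: fsubsetUr.
  case: (star1 _ gX (imS _ fg)) => ->; case: (star1 _ hX (imS _ fh)) => ->;
    rewrite ?fsetIid ?fsubset_refl // ?awf // fsetIC 1?[(w |` f) `&` _]fsetIC ?awf //.
have g0S' : w |` (f `\ x0) \in S' by apply/(replaceP fS wS); right; exists x0.
have [L2 [psi2 [_ L2K2 rL2]]] : exists L psi', [/\ gstellar_equiv (quot X2 p' [fset a]) L,
    gstellar_equiv L (quot X2 p' [fset a]) &
    @realizes L (stellar_sub [fset a; w] b X2) p' (b |` [fset a]) psi'].
  apply: (sub_equiv (g0 := a |` (w |` (f `\ x0))) V2 (quot_realizes _ _ _)) => //.
  - by apply/fset0Pn; exists a; rewrite !inE eqxx.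
  - by rewrite in_fsetU; apply/orP; left; apply/coneP; exists (w |` (f `\ x0)).
  - by rewrite fsubUset !fsub1set !inE !eqxx orbT.
  - apply/negP => /in_verts[g]; rewrite in_fsetU => /orP[/coneP[h hS ->]|/T'P[gM _ _]]; last first.
      by rewrite (negPf (notin_verts bM gM)).
    rewrite !inE (negPf ba) /=; case: (S'sub _ hS) => [gS|/fsubsetP hw].
      by rewrite (negPf (notin_verts bS gS)).
    by move=> /hw; rewrite !inE (negPf bw) (negPf bf).
  - apply: imb => g; rewrite in_fsetU => /orP[/coneP[h hS ->]|/T'P[gM _ _]].
      by apply: bim; exact: S'im.
    by rewrite p'T // (notin_verts bM gM).
  - left; apply/negP => /fdisjointP/(_ a); rewrite inE eqxx; move=> H.
    by have := H; rewrite -{1}p'a mem_im ?inE ?eqxx // => /(_ isT).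
have E12 : stellar_sub [fset a; w] b X2 = stellar_sub f b X1.
  have e1 x : x \in f -> (a |` (w |` (f `\ x))) `\ a = (w |` f) `\ x.
    move=> xf; rewrite fsetU1K.
      apply/fsetP => z; rewrite !inE; case: (z =P w) => //= ->.
      by rewrite andbT; apply/esym; apply: contraNneq wf => ->.
    by rewrite !inE eq_sym (negPf wa) (negPf af) andbF.
  have e2 x : x \in f -> (a |` (w |` (f `\ x))) `\ w = (a |` f) `\ x.
    move=> xf; rewrite fsetUCA fsetU1K.
      apply/fsetP => z; rewrite !inE; case: (z =P a) => //= ->.
      by rewrite andbT; apply/esym; apply: contraNneq af => ->.
    by rewrite !inE (negPf wa) (negPf wf) andbF.
  have aT' g : g \in T' -> a \notin g by move=> /T'P[gM _ _]; exact: notin_verts aM gM.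
  have awsub g : ([fset a; w] `<=` g) = (a \in g) && (w \in g) by rewrite fsubUset !fsub1set.
  have coneS g : g \in S -> w \notin a |` g.
    by move=> gS; rewrite !inE (negPf wa) (negPf (notin_verts wS gS)).
  have apexf x : x \in f -> a |` (w |` (f `\ x)) \in X2.
    move=> xf; rewrite in_fsetU; apply/orP; left; apply/coneP.
    by exists (w |` (f `\ x)) => //; apply/(replaceP fS wS); right; exists x.
  apply/fsetP => h; apply/stellar_subP/stellar_subP.
    case=> [[g [v [gX awg vaw ->]]]|[hX awh]].
      move: gX; rewrite in_fsetU => /orP[/coneP[g' gS' ge]|/aT' ag]; last first.
        by move: awg; rewrite awsub (negPf ag).
      left; case/(replaceP fS wS): gS' => [[_ gS]|[x xf g'e]].
        by move: awg; rewrite awsub ge (negPf (coneS _ gS)) andbF.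
      move: vaw; rewrite ge g'e !inE => /orP[]/eqP ->.
        by exists (w |` f), x; rewrite e1 // fsubsetUr.
      by exists (a |` f), x; rewrite e2 // fsubsetUr.
    right; split.
      move: hX; rewrite !in_fsetU => /orP[/coneP[g' gS' ge]|->]; last by rewrite !orbT.
      case/(replaceP fS wS): gS' => [[_ gS]|[x xf g'e]].
        by apply/orP; left; apply/coneP; exists g'.
      by move: awh; rewrite awsub ge g'e !inE !eqxx !orbT.
    apply/negP => fh; have [he|he] : h = a |` f \/ h = w |` f.
      apply: star1; last exact: imS.
      move: hX; rewrite !in_fsetU => /orP[/coneP[g' gS' ge]|->]; last by rewrite !orbT.
      case/(replaceP fS wS): gS' => [[_ gS]|[x xf g'e]].
        by apply/orP; left; apply/coneP; exists g'.
      by move: awh; rewrite awsub ge g'e !inE !eqxx !orbT.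
    - move: hX; rewrite he in_fsetU => /orP[/coneP[g' gS' ge]|/aT']; last by rewrite fset1U1.
      have g'f : g' = f by rewrite -(fsetU1K (notin_verts aS' gS')) -ge fsetU1K.
      case/(replaceP fS wS): gS' => [[/eqP //]|[x xf g'e]].
      by move: wf; rewrite -g'f g'e fset1U1.
    - move: hX; rewrite he in_fsetU => /orP[/coneP[g' gS' ge]|/T'P[gM _ _]].
        by have := fset1U1 a g'; rewrite -ge !inE eq_sym (negPf wa) (negPf af).
      by have := notin_verts wM gM; rewrite fset1U1.
  case=> [[g [x [gX fg xf ->]]]|[hX fh]].
    left; case: (star1 _ gX (imS _ fg)) => ->.
      exists (a |` (w |` (f `\ x))), w; rewrite e2 // awsub; split=> //; first exact: apexf.
        by rewrite !inE !eqxx !orbT.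
      by rewrite !inE eqxx orbT.
    exists (a |` (w |` (f `\ x))), a; rewrite e1 // awsub; split=> //; first exact: apexf.
      by rewrite !inE !eqxx !orbT.
    by rewrite !inE eqxx.
  right; move: hX; rewrite !in_fsetU in_fset1 awsub.
  case/or3P=> [/coneP[g gS he]|/eqP he|hT].
  - split; last by rewrite he (negPf (coneS _ gS)) andbF.
    apply/orP; left; apply/coneP; exists g => //; apply/(replaceP fS wS); left; split=> //.
    by apply: contraNneq fh => gf; rewrite he gf fsubsetUr.
  - by rewrite he fsubsetUr in fh.
  - by rewrite hT orbT (negPf (aT' _ hT)).
have VL1 := valid_sub f V1 bX1 bpX1 p'b.
have MT' : M `\` T' = t |` (M `\` T).
  apply/fsetP => g; rewrite !inE; have [->|_] //= := eqVneq g t.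
have tMT : t \notin M `\` T by rewrite inE tT.
exists S', T', p'; split; last by rewrite [X in (_ < X)%N](cardfsD1 t) tT.
split=> //.
- by apply: fsubset_trans (uf_sub U); exact: fsubD1set.
- by rewrite MT'; apply/fset0Pn; exists t; exact: fset1U1.
- apply: rt_trans (uf_sphere U); apply: rt_step; constructor 2.
  exact: weld_replace fS wS (uf_card U) f0.
- have [k kE] := uf_count U; exists (fun G => k G + (im p' f == G))%N => G.
  rewrite MT' big_fsetU1 //= kE.
  have := sum_replace fS wS (fun g => (im p' g == G) : nat).
  rewrite sum_bd // p'wf.
  have -> : (\sum_(g <- S) (im p' g == G) = \sum_(g <- S) (im p g == G))%N.
    by rewrite big_seq [RHS]big_seq; apply: eq_bigr => g gS; rewrite p'SE.
  by rewrite -/S'; exact: count_arith.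
exists (quot X2 p' [fset a]), (fun g => val g); split; last exact: quot_realizes.
apply: rt_trans MK _; apply: rt_trans KL1 _; apply: rt_trans L2K2.
by apply: (realizes_equiv VL1 rL1 (psi' := psi2)); rewrite -E12.
Qed.
End Step.
End Unfolding.

Lemma unfolding_complete (R : realType) n M a S T p :
  stellar_manifold n M -> connected (realization R M) -> a \notin verts M ->
  unfolding n M a S T p -> exists S' p', unfolding n M a S' fset0 p'.
Proof.
move=> mM conn aM; have [m] := ubnP #|` T|; elim: m S T p => // m IH S T p Tm U.
have [T0|T0] := eqVneq T fset0; first by exists S, p; rewrite -T0.
have [S' [T' [p' [U' lt]]]] := unfolding_step mM conn aM U T0.
exact: IH (leq_trans lt (ltnSE Tm)) U'.
Qed.

(** * The regular equivalence *)

Section Final.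
Variables (n : nat) (M S : complex) (a : int) (p : int -> int).
Hypothesis U : unfolding n M a S fset0 p.
Hypotheses (aM : a \notin verts M) (thinM : thin M).

Let e : rel int := [rel v w | p v == p w].

(** Generators have the same number of vertices and embed by [p], so an
    inclusion of images is an equality. *)
Lemma gen_equivP g h : g \in S -> h \in S -> gen_equiv e g h <-> im p g = im p h.
Proof.
move=> gS hS; split=> [gh|E v vg].
  apply: sub_gen; first by rewrite !card_im ?(uf_card U) //; exact: uf_inj U _ _.
  apply/fsubsetP => _ /imP[v /gh [w wh vw] ->].
  by case: vw => [->|/eqP ->]; exact: mem_im.
have : p v \in im p h by rewrite -E; exact: mem_im.
by move=> /imP[w wh vw]; exists w => //; right; apply/eqP.
Qed.

Let twins F := [fset g in S | im p g == F].

Lemma card_facet_le2 F : (#|` [fset t in M | F \in simplex_bd t]| <= 2)%N.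
Proof.
apply: card_le2 => x y z; rewrite !inE => /andP[xM Fx] /andP[yM Fy] /andP[zM Fz].
have [u cu ->] := facet_coface xM Fx; have [v cv ->] := facet_coface yM Fy.
have [w cw ->] := facet_coface zM Fz.
by have [->|->|->] := thinM cu cv cw; [constructor 1|constructor 2|constructor 3].
Qed.

(** Everything being absorbed, [uf_count] compares the generators of [S] over
    [F] with all the generators of [M] around [F]. *)
Lemma card_twins F : exists k,
  #|` [fset t in M | F \in simplex_bd t]| = (#|` twins F| + k.*2)%N.
Proof.
have [k /(_ F) kE] := uf_count U; exists (k F).
by rewrite -!sum_card -kE fsetD0.
Qed.

Lemma twins_le2 F : (#|` twins F| <= 2)%N.
Proof.
have [k kE] := card_twins F; apply: leq_trans (card_facet_le2 F).
by rewrite kE leq_addr.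
Qed.

Lemma regular_unfolding : regular S e.
Proof.
split.
- by move=> x y z _ _ _; split=> [|/eqP E]; rewrite /e /= ?eqxx ?E.
- by move=> g gS v w vg wg /eqP; exact: uf_inj U _ gS _ _ vg wg.
move=> g h k gS; rewrite !inE => /andP[hg hS] /andP[kg kS].
move=> /(gen_equivP gS hS) gh /(gen_equivP gS kS) gk.
apply/eqP; rewrite -[_ == _]negbK; apply/negP => hk.
have := twins_le2 (im p g).
rewrite (cardfsD1 g) (cardfsD1 h) (cardfsD1 k) !inE eqxx gS hS kS gh -gk gh eqxx hg kg.
by rewrite eq_sym hk.
Qed.

(** In a closed [M] the generators around a facet are even in number, hence so
    are those of [S] over it: they are two. *)
Lemma twin_unique g : closed_complex M -> g \in S ->
  exists! h : simplex, h \in S `\ g /\ gen_equiv e g h.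
Proof.
move=> cM gS; set F := im p g.
have gF : g \in twins F by rewrite !inE gS eqxx.
have even : odd #|` [fset t in M | F \in simplex_bd t]| = false.
  apply/negP => oF; have [k kE] := card_twins F.
  have : F \in boundary M.
    have [t] : exists t, t \in [fset t in M | F \in simplex_bd t].
      apply/fset0Pn; rewrite -cardfs_gt0; exact: odd_gt0.
    rewrite /boundary !inE /= oF andbT => /andP[tM Ft].
    by apply/bigfcupP; exists t; rewrite ?tM.
  by rewrite cM inE.
have c1 : #|` twins F `\ g| = 1%N.
  have [k kE] := card_twins F; have := twins_le2 F.
  move: even; rewrite kE oddD odd_double addbF (cardfsD1 g) gF.
  by case: #|` _| => [|[|?]].
have [h hE] : exists h, twins F `\ g = [fset h] by apply/cardfs1P; rewrite c1.
have key k : (k \in S `\ g /\ gen_equiv e g k) <-> k = h.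
  have -> : k = h <-> k \in twins F `\ g.
    by rewrite hE inE; split=> [->|/eqP].
  rewrite !inE; split.
    by move=> [/andP[-> kS] /(gen_equivP gS kS)]; rewrite /F => ->; rewrite kS eqxx.
  by move=> /and3P[-> kS /eqP kF]; rewrite kS; split=> //; apply/gen_equivP.
by exists h; split=> [|k /key //]; apply/key.
Qed.

Lemma class_reprE v : v \in verts S ->
  exists2 w, w \in verts S & class_repr S e v = w /\ p v = p w.
Proof.
move=> vS; rewrite /class_repr; case E : [seq w <- verts S | e v w] => [|w s] /=.
  by have := mem_filter (e v) v (verts S); rewrite E vS /e /= eqxx.
exists w; have : w \in [seq w <- verts S | e v w] by rewrite E inE eqxx.
  by rewrite mem_filter => /andP[].
by rewrite mem_filter => /andP[/eqP].
Qed.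

(** The final cone and the quotient have the same presentation up to the
    labels: a vertex of [S] is labelled in the first one by the vertex of [M]
    that it lies over, and in the second one by the representative [rho] of
    its class. The function [f] goes from the former label to the latter. *)
Lemma cone_quotient_equiv : gstellar_equiv (gcomplex_of M) (cone_quotient S a e).
Proof.
have [K [psi [MK rK]]] := uf_equiv U; apply: rt_trans MK _.
rewrite fsetU0 in rK.
pose rho v := if v == a then a else class_repr S e v.
have rhoa : rho a = a by rewrite /rho eqxx.
have aS := uf_apex U.
have rhoS g : g \in S -> {in g, rho =1 class_repr S e}.
  by move=> gS v vg; rewrite /rho; case: eqP => // va; have := notin_verts aS gS; rewrite -va vg.
have rhog g : g \in S -> im rho g = class_image S e g.
  by move=> gS; apply: eq_in_im; exact: rhoS.
have rhoU g : g \in S -> im rho (a |` g) = a |` class_image S e g.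
  by move=> gS; rewrite im_U1 rhoa rhog.
have rQ : @realizes (cone_quotient S a e) (cone a S) rho [fset a] (fun g => a |` val g).
  split.
  - move=> g h /= E; apply: val_inj => /=.
    by rewrite -(fsetU1K (notin_verts aS (valP g))) E fsetU1K // (notin_verts aS (valP h)).
  - by move=> g; apply/coneP; exists (val g) => //; exact: valP.
  - by move=> _ /coneP[g gS ->]; exists [` gS].
  - by move=> g /=; rewrite rhoU //; exact: valP.
  move=> g h F /=; rewrite /qglue !rhoU ?(valP g) ?(valP h) // fdisjointX1 negbK.
  have -> : (a |` val g) `&` (a |` val h) = a |` (val g `&` val h) by rewrite fsetUIr.
  rewrite im_U1 rhoa; congr (_ && (_ ==> (_ `<=` _ |` _))).
  apply/esym/eq_in_im => v; rewrite inE => /andP[vg _]; exact: rhoS (valP g) _ vg.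
have pS v : v \in verts S -> p v \in verts M.
  move=> /in_verts[g gS vg]; move/fsubsetP: (uf_im U gS); apply; exact: mem_im.
have conev v : v \in verts (cone a S) -> v = a \/ v \in verts S.
  move=> /in_verts[_ /coneP[g gS ->]]; rewrite !inE => /orP[/eqP|vg]; first by left.
  by right; apply/in_verts; exists g.
have VK : valid n (cone a S) p [fset a].
  have := @valid_cone n M a p S fset0 aM (uf_pa U) aS (uf_card U) (uf_inj U) (uf_im U).
  by rewrite fsetU0; apply.
have rhoE v : v \in verts S -> rho v \in verts S /\ p (rho v) = p v.
  move=> vS; rewrite /rho; case: eqP => [va|_]; first by rewrite -va vS in aS.
  by have [w wS [-> ->]] := class_reprE vS.
have rhoeq v w : v \in verts S -> w \in verts S -> p v = p w -> rho v = rho w.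
  move=> vS wS pvw; rewrite /rho; case: eqP => [va|_]; first by rewrite -va vS in aS.
  case: eqP => [va|_]; first by rewrite -va wS in aS.
  rewrite /class_repr; have -> : [seq u <- verts S | e v u] = [seq u <- verts S | e w u].
    by apply: eq_filter => u; rewrite /e /= pvw.
  have : w \in [seq u <- verts S | e w u] by rewrite mem_filter wS /e /= eqxx.
  by case: [seq _ <- _ | _].
have VQ : valid n (cone a S) rho [fset a].
  have inj g : g \in S -> {in g &, injective rho}.
    move=> gS u v ug vg E; apply: (uf_inj U gS ug vg).
    have [uS vS] : u \in verts S /\ v \in verts S by split; apply/in_verts; exists g.
    by rewrite -(proj2 (rhoE u uS)) E (proj2 (rhoE v vS)).
  have := @valid_cone n S a rho S fset0 aS rhoa aS (uf_card U) inj.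
  rewrite fsetU0; apply=> // g gS; apply/fsubsetP => _ /imP[v vg ->].
  by apply: (proj1 (rhoE v _)); apply/in_verts; exists g.
pose f y := if y == a then a else rho (head y [seq w <- verts S | p w == y]).
have fa : f a = a by rewrite /f eqxx.
have fE v : v \in verts S -> f (p v) = rho v.
  move=> vS; rewrite /f; case: eqP => [E|_].
    by have := pS _ vS; rewrite E (negPf aM).
  have : v \in [seq w <- verts S | p w == p v] by rewrite mem_filter vS eqxx.
  case E : [seq _ <- _ | _] => [//|w s] _ /=.
  have : w \in [seq w <- verts S | p w == p v] by rewrite E inE eqxx.
  by rewrite mem_filter => /andP[/eqP pw wS]; exact: rhoeq.
have rhona v : v \in verts S -> rho v != a.
  by move=> vS; apply: contraNneq aS => <-; exact: (proj1 (rhoE v vS)).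
have pna v : v \in verts S -> p v != a.
  by move=> vS; apply: contraNneq aM => <-; exact: pS.
apply: (renumbering_equiv (f := f) VK VQ rK rQ).
- by move=> v /conev[->|vS]; rewrite ?(uf_pa U) ?fa // fE.
- move=> _ _ /imP[u uX ->] /imP[v vX ->].
  case: (conev _ uX) => [->|uS]; case: (conev _ vX) => [->|vS] //; rewrite ?(uf_pa U) ?fa ?fE //.
  + by move=> E; have := rhona _ vS; rewrite -E eqxx.
  + by move=> E; have := rhona _ uS; rewrite E eqxx.
  + by move=> E; rewrite -(proj2 (rhoE u uS)) E (proj2 (rhoE v vS)).
move=> _ /imP[v vX ->]; case: (conev _ vX) => [->|vS]; first by rewrite (uf_pa U) fa.
by rewrite fE // !inE (negPf (rhona _ vS)) (negPf (pna _ vS)).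
Qed.
End Final.

Theorem theorem2p1 (R : realType) (n : nat) (M : complex)
    (M_nonempty : M != fset0)
    (M_manifold : stellar_manifold n M)
    (M_connected : connected (realization R M)) :
  exists (S : complex) (a : int) (e : rel int),
    [/\ stellar_sphere n S,
        a \notin verts S,
        regular S e,
        gstellar_equiv (gcomplex_of M) (cone_quotient S a e) &
        closed_complex M ->
          forall g : simplex, g \in S ->
            exists! p : simplex, p \in S `\ g /\ gen_equiv e g p].
Proof.
have [t0 t0M] := fset0Pn _ M_nonempty.
have [a aM] := fresh_int (verts M).
have U0 := unfolding_start M_manifold aM t0M.
have [S [p U]] := unfolding_complete M_manifold M_connected aM U0.
have thinM := thin_manifold M_manifold M_connected.
exists S, a, [rel v w | p v == p w]; split.
- exact: uf_sphere U.
- exact: uf_apex U.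
- exact: regular_unfolding U thinM.
- exact: cone_quotient_equiv U aM.
- by move=> cM g; exact: twin_unique U thinM _ cM.
Qed.
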